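(* There exists a transcendental self-map of $\mathbb{C}^*$ that has a doubly connected Baker domain.
   Context: $\mathbb{C}^*=\mathbb{C}\setminus\{0\}$, $\widehat{\mathbb{C}}=\mathbb{C}\cup\{\infty\}$. A transcendental self-map of $\mathbb{C}^*$ is a holomorphic map $f:\mathbb{C}^*\to\mathbb{C}^*$ for which both $0$ and $\infty$ are essential singularities. $f^n$ denotes the $n$-th iterate. The Fatou set $F(f)$ is the set of $z\in\mathbb{C}^*$ having an open neighbourhood on which $\{f^n\}_{n\in\mathbb{N}}$ is a normal family; a Fatou component is a connected component of $F(f)$. For a Fatou component $U$, let $U_n$ be the Fatou component containing $f^n(U)$; $U$ is periodic if $U\subseteq U_p$ for some $p\in\mathbb{N}$. The escaping set is $I(f)=\{z\in\mathbb{C}^*:\omega(z,f)\subseteq\{0,\infty\}\}$, where $\omega(z,f)=\bigcap_{n\in\mathbb{N}}\overline{\{f^k(z):k\ge n\}}$ with closure taken in $\widehat{\mathbb{C}}$. A Baker domain is a periodic Fatou component that meets $I(f)$ (in which case it is contained in $I(f)$). A domain is doubly connected if its complement in $\widehat{\mathbb{C}}$ has exactly two connected components. *)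

(* Defs.v *)
From HB Require Import structures.
From mathcomp Require Import all_boot all_order all_algebra.
From mathcomp Require Import all_classical all_reals all_analysis.
From mathcomp Require Import complex.

Set Implicit Arguments.
Unset Strict Implicit.
Unset Printing Implicit Defensive.

Import Order.TTheory GRing.Theory Num.Theory numFieldNormedType.Exports.

Local Open Scope classical_set_scope.
Local Open Scope ring_scope.

(* Typing R[i] as a numFieldType gives it the topology and the normed module
   structure over itself that MathComp-Analysis attaches to any numFieldType,
   so that "derivable f z 1" is complex differentiability at z. *)
Definition CC (R : realType) : numFieldType := R[i].

(* Finite points are "Some z" and the point at infinity is "None". *)
Definition sphere (R : realType) : topologicalType :=
  one_point_compactification (CC R).

Section ComplexDynamics.
Variable R : realType.

Local Notation C := (CC R).
Local Notation Chat := (sphere R).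

Definition to_sphere (z : C) : Chat := Some z.

(* The norm of R[i] takes its (real, nonnegative) values in R[i]. *)
Definition cabs (z : C) : R := complex.Re (`|z| : R[i]).

Definition chordal (p q : Chat) : R :=
  match p, q with
  | Some z, Some w =>
      cabs (z - w) / (Num.sqrt (1 + cabs z ^+ 2) * Num.sqrt (1 + cabs w ^+ 2))
  | Some z, None | None, Some z => (Num.sqrt (1 + cabs z ^+ 2))^-1
  | None, None => 0
  end.

Definition Cstar : set C := [set z | z != 0].

Definition holomorphic_on (W : set C) (f : C -> C) : Prop :=
  forall z, W z -> derivable f z 1.

Definition removable_at0 (f : C -> C) : Prop :=
  exists g : C -> C, (\forall z \near (0 : C), derivable g z 1) /\
                     (\forall z \near (0 : C)^', g z = f z).

Definition pole_at0 (f : C -> C) : Prop :=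
  to_sphere (f z) @[z --> (0 : C)^'] --> (None : Chat).

(* To be used for f holomorphic on a punctured neighbourhood of 0. *)
Definition essential_singularity_at0 (f : C -> C) : Prop :=
  ~ removable_at0 f /\ ~ pole_at0 f.

Definition essential_singularity_at_infty (f : C -> C) : Prop :=
  essential_singularity_at0 (fun z => f z^-1).

(* A self-map of Cstar is represented by a function on C; its value at 0 is
   irrelevant to every definition below. *)
Definition transcendental_self_map (f : C -> C) : Prop :=
  [/\ (forall z, Cstar z -> Cstar (f z)),
      holomorphic_on Cstar f,
      essential_singularity_at0 f &
      essential_singularity_at_infty f].

Definition locally_uniform_cvg (W : set C) (h : nat -> C -> Chat)
    (g : C -> Chat) : Prop :=
  forall z, W z -> exists2 V : set C, nbhs z V &
    forall e : R, 0 < e ->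
      \forall n \near \oo, forall w, V w -> W w -> chordal (h n w) (g w) < e.

(* The limit functions may take the values 0 and infinity. *)
Definition normal_family (W : set C) (F : set (C -> Chat)) : Prop :=
  forall h : nat -> C -> Chat, (forall n, F (h n)) ->
    exists2 s : nat -> nat, {homo s : m n / (m < n)%N} &
      exists g : C -> Chat, locally_uniform_cvg W (h \o s) g.

Definition iterates (f : C -> C) : set (C -> Chat) :=
  [set h | exists n : nat, h = to_sphere \o iter n f].

Definition fatou_set (f : C -> C) : set C :=
  [set z | exists W : set C,
     [/\ open W, W z, W `<=` Cstar & normal_family W (iterates f)]].

Definition fatou_component (f : C -> C) (U : set C) : Prop :=
  exists2 z, fatou_set f z & U = connected_component (fatou_set f) z.

(* V is the component U_p containing f^p(U). *)
Definition periodic_component (f : C -> C) (U : set C) : Prop :=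
  exists p : nat, (0 < p)%N /\
    exists V : set C, [/\ fatou_component f V, iter p f @` U `<=` V & U `<=` V].

Definition omega_limit (f : C -> C) (z : C) : set Chat :=
  \bigcap_(n in [set: nat])
     closure [set to_sphere (iter k f z) | k in [set k | (n <= k)%N]].

Definition escaping_set (f : C -> C) : set C :=
  [set z | Cstar z /\ omega_limit f z `<=` [set to_sphere 0; None]].

Definition baker_domain (f : C -> C) (U : set C) : Prop :=
  [/\ fatou_component f U, periodic_component f U &
      U `&` escaping_set f !=set0].

Definition components (T : topologicalType) (K : set T) : set (set T) :=
  [set connected_component K x | x in K].

Definition is_domain (U : set C) : Prop := [/\ open U, connected U & U !=set0].

Definition doubly_connected (U : set C) : Prop :=
  is_domain U /\ (components (~` (to_sphere @` U)) #= `I_2)%card.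

End ComplexDynamics.

(* Main.v *)
Require Import Defs.
From HB Require Import structures.
From mathcomp Require Import all_boot all_order all_algebra.
From mathcomp Require Import all_classical all_reals all_analysis.
From mathcomp Require Import complex ring lra finmap.

(* Ein(z) = int_0^z (1 - e^(-t)) / t dt is entire and equals log z + const up to an
   exponentially small error in the right half-plane. Hence
   f(z) = 64 exp(Ein(z) + eps / z) omits 0, has essential singularities at 0 and oo,
   behaves like a dilation on a cone around the positive real axis, which it maps
   into itself with f^n -> oo uniformly, and for small eps maps some circle |z| = r
   close to 64, that is, into the cone. The circle and the ray [r, oo) thus lie in one
   Fatou component U. In U the iterates tend to oo locally uniformly: the set where
   they do is closed in U by normality and open by a Harnack inequality. A component
   of the complement of U containing neither 0 nor oo would be surrounded by a
   compact part of U, and the maximum principle for 1 / f^n would put it into the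
   Fatou set; the circle separates the two components that remain.

   In place of Cauchy theory, the maximum principle comes from a second-order
   expansion at every point; it gives the open mapping property (needed for
   f(U) <= U) and a weak Schwarz lemma, from which Harnack's inequality follows. *)

Set Implicit Arguments.
Unset Strict Implicit.
Unset Printing Implicit Defensive.
Import Order.TTheory GRing.Theory Num.Theory numFieldNormedType.Exports.
Local Open Scope classical_set_scope.
Local Open Scope ring_scope.

(** * The complex plane with its real-valued modulus *)

Section ComplexPlane.
Variable R : realType.
Local Notation C := (CC R).

(** On the right, e^(Ein z) is close to e^gamma z with Euler's gamma; on the negative axis Ein z and
    eps / z are both nonpositive. So [f] is unbounded along one half-axis and bounded along the
    other, near 0 (thanks to eps / z) as well as near infinity. Working with only two orders of
    expansion has a price: openness of [f] is within reach only where the first or the second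
    coefficient is nonzero. Hence all critical points of [f] have to be simple, which is a second
    smallness condition on eps, beside the one from the circle. Harnack's inequality needs the
    logarithm of an iterate; as f = exp(L) with L smooth off 0, log |f^(n+1)| is the real part of
    L(f^n), and no branch has to be chosen. Normality enters only through the chordal distance to
    infinity, so limit functions are never identified. A component of the complement of U need not
    be isolated from the others; the hole to be filled is therefore a relatively clopen piece of the
    complement, found by the theory of quasi-components. The factor 64 is both the image of points
    where the exponent vanishes, well inside a cone with vertex 32, and a slope that outweighs the
    nonlinear error on this cone. *)

Definition re (z : C) : R := complex.Re (z : R[i]).
Definition im (z : C) : R := complex.Im (z : R[i]).
Definition mkc (x y : R) : C := (Complex x y : R[i]).
Definition rc (x : R) : C := mkc x 0.

Lemma reD z w : re (z + w) = re z + re w. Proof. by case: z w => [a b] [c d]. Qed.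
Lemma imD z w : im (z + w) = im z + im w. Proof. by case: z w => [a b] [c d]. Qed.
Lemma reN z : re (- z) = - re z. Proof. by case: z. Qed.
Lemma imN z : im (- z) = - im z. Proof. by case: z. Qed.
Lemma reM z w : re (z * w) = re z * re w - im z * im w.
Proof. by case: z w => [a b] [c d]. Qed.
Lemma imM z w : im (z * w) = re z * im w + im z * re w.
Proof. by case: z w => [a b] [c d]. Qed.
Lemma re0 : re 0 = 0. Proof. by []. Qed.
Lemma im0 : im 0 = 0. Proof. by []. Qed.
Lemma re1 : re 1 = 1. Proof. by []. Qed.
Lemma im1 : im 1 = 0. Proof. by []. Qed.
Lemma re_mkc x y : re (mkc x y) = x. Proof. by []. Qed.
Lemma im_mkc x y : im (mkc x y) = y. Proof. by []. Qed.
Lemma re_rc x : re (rc x) = x. Proof. by []. Qed.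
Lemma im_rc x : im (rc x) = 0. Proof. by []. Qed.
Definition reimE := (reD, imD, reN, imN, reM, imM, re0, im0, re1, im1,
  re_mkc, im_mkc, re_rc, im_rc).

Lemma complex_ext z w : re z = re w -> im z = im w -> z = w.
Proof. by case: z w => [a b] [c d] /= -> ->. Qed.

Lemma rcD x y : rc (x + y) = rc x + rc y.
Proof. by apply: complex_ext; rewrite !reimE ?addr0. Qed.
Lemma rcM x y : rc (x * y) = rc x * rc y.
Proof. by apply: complex_ext; rewrite !reimE; ring. Qed.
Lemma rcN x : rc (- x) = - rc x.
Proof. by apply: complex_ext; rewrite !reimE ?oppr0. Qed.
Lemma rc0 : rc 0 = 0. Proof. by []. Qed.
Lemma rc1 : rc 1 = 1. Proof. by []. Qed.
Lemma rcX x n : rc (x ^+ n) = rc x ^+ n.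
Proof. by elim: n => // n IH; rewrite !exprS rcM IH. Qed.

Lemma normE (z : C) : `|z| = rc (cabs z).
Proof. by rewrite /cabs /rc /mkc [ `|z|]normc_def. Qed.

Lemma cabsE (z : C) : cabs z = Num.sqrt (re z ^+ 2 + im z ^+ 2).
Proof. by rewrite /cabs [ `|z|]normc_def. Qed.

Lemma cabs_sqr (z : C) : cabs z ^+ 2 = re z ^+ 2 + im z ^+ 2.
Proof. by rewrite cabsE sqr_sqrtr// addr_ge0// sqr_ge0. Qed.

Lemma cabs_ge0 (z : C) : 0 <= cabs z.
Proof. by rewrite cabsE sqrtr_ge0. Qed.
#[local] Hint Resolve cabs_ge0 : core.

Lemma rc_inj : injective rc.
Proof. by move=> x y /(congr1 re). Qed.

Lemma cabsM (z w : C) : cabs (z * w) = cabs z * cabs w.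
Proof. by apply: rc_inj; rewrite rcM -!normE normrM. Qed.

Lemma cabsN (z : C) : cabs (- z) = cabs z.
Proof. by apply: rc_inj; rewrite -!normE normrN. Qed.

Lemma cabs0 : cabs (0 : C) = 0.
Proof. by apply: rc_inj; rewrite -!normE normr0. Qed.

Lemma cabs1 : cabs (1 : C) = 1.
Proof. by apply: rc_inj; rewrite -!normE normr1. Qed.

Lemma cabs_eq0 (z : C) : (cabs z == 0) = (z == 0).
Proof. by rewrite -(inj_eq rc_inj) -normE normr_eq0. Qed.

Lemma cabs_gt0 (z : C) : (0 < cabs z) = (z != 0).
Proof. by rewrite lt_def cabs_ge0 andbT cabs_eq0. Qed.

Lemma cabsV (z : C) : cabs z^-1 = (cabs z)^-1.
Proof.
have [->|z0] := eqVneq z 0; first by rewrite invr0 cabs0 invr0.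
apply: (@mulfI _ (cabs z)); first by rewrite cabs_eq0.
by rewrite -cabsM !divff ?cabs_eq0// cabs1.
Qed.

Lemma cabsX (z : C) n : cabs (z ^+ n) = cabs z ^+ n.
Proof. by elim: n => [|n IH]; rewrite ?expr0 ?cabs1// !exprS cabsM IH. Qed.

Lemma leC_rc x y : (rc x <= rc y) = (x <= y).
Proof. exact: lecR. Qed.
Lemma ltC_rc x y : (rc x < rc y) = (x < y).
Proof. exact: ltcR. Qed.

Lemma cabsD (z w : C) : cabs (z + w) <= cabs z + cabs w.
Proof. by rewrite -leC_rc rcD -!normE ler_normD. Qed.

Lemma cabsB (z w : C) : cabs (z - w) <= cabs z + cabs w.
Proof. by rewrite -(cabsN w) cabsD. Qed.

Lemma cabsC (z w : C) : cabs (z - w) = cabs (w - z).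
Proof. by rewrite -opprB cabsN. Qed.

Lemma cabs_triangle (u z w : C) : cabs (z - w) <= cabs (z - u) + cabs (u - w).
Proof. by rewrite -[z - w](subrKA u) cabsD. Qed.

Lemma cabs_ge_re (z : C) : `|re z| <= cabs z.
Proof. by rewrite cabsE -sqrtr_sqr ler_wsqrtr// lerDl sqr_ge0. Qed.
Lemma cabs_ge_im (z : C) : `|im z| <= cabs z.
Proof. by rewrite cabsE -sqrtr_sqr ler_wsqrtr// lerDr sqr_ge0. Qed.

Lemma cabs_le_reim (z : C) : cabs z <= `|re z| + `|im z|.
Proof.
rewrite cabsE -[leRHS]ger0_norm ?addr_ge0// -sqrtr_sqr ler_wsqrtr//.
rewrite -(real_normK (num_real (re z))) -(real_normK (num_real (im z))).
by have := normr_ge0 (re z); have := normr_ge0 (im z); nra.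
Qed.

Lemma cabs_rc x : cabs (rc x) = `|x|.
Proof. by rewrite cabsE !reimE expr0n addr0 sqrtr_sqr. Qed.

Lemma posC (e : C) : 0 < e -> exists2 d : R, 0 < d & e = rc d.
Proof.
case: e => a b; rewrite ltcE /= => /andP[/eqP -> a0].
by exists a.
Qed.

Lemma nbhsCP (z : C) (V : set C) :
  nbhs z V <-> exists2 d : R, 0 < d & forall w, cabs (w - z) < d -> V w.
Proof.
split.
  move=> /nbhs_ballP[e /= /posC[d d0 ->]] H; exists d => // w wd.
  by apply: H; rewrite -ball_normE /= distrC normE ltC_rc.
move=> [d d0 H]; apply/nbhs_ballP; exists (rc d); first by rewrite /= -rc0 ltC_rc.
by move=> w; rewrite -ball_normE /= distrC normE ltC_rc => /H.
Qed.

Definition disc (z : C) (d : R) : set C := [set w | cabs (w - z) < d].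
Definition cdisc (z : C) (d : R) : set C := [set w | cabs (w - z) <= d].

Lemma nbhs_disc z d : 0 < d -> nbhs z (disc z d).
Proof. by move=> d0; apply/nbhsCP; exists d. Qed.

Lemma disc_center z d : 0 < d -> disc z d z.
Proof. by move=> d0; rewrite /disc /= subrr cabs0. Qed.

Lemma open_disc z d : open (disc z d).
Proof.
rewrite openE => w wd; apply/nbhsCP; exists (d - cabs (w - z)).
  by rewrite subr_gt0.
move=> u uw; rewrite /disc /=; apply: le_lt_trans (cabs_triangle w _ _) _.
by rewrite -ltrBrDr.
Qed.

Lemma nbhs_RP (x : R) (V : set R) :
  nbhs x V <-> exists2 d : R, 0 < d & forall y, `|y - x| < d -> V y.
Proof.
split.
  move=> /nbhs_ballP[e /= e0] H; exists e => // w wd.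
  by apply: H; rewrite -ball_normE /= distrC.
move=> [d d0 H]; apply/nbhs_ballP; exists d => // w.
by rewrite -ball_normE /= distrC => /H.
Qed.

Lemma cvg_CP (f : C -> C) (z l : C) : f x @[x --> z] --> l <->
  forall e : R, 0 < e -> exists2 d : R, 0 < d &
    forall w, cabs (w - z) < d -> cabs (f w - l) < e.
Proof.
split=> [H e e0|H V /nbhsCP[e e0 eV]].
  by have /H /nbhsCP : nbhs l (disc l e) by exact: nbhs_disc.
by have [d d0 dH] := H e e0; apply/nbhsCP; exists d => // w /dH /eV.
Qed.

Lemma cvg_CRP (f : C -> R) (z : C) (l : R) : f x @[x --> z] --> l <->
  forall e : R, 0 < e -> exists2 d : R, 0 < d &
    forall w, cabs (w - z) < d -> `|f w - l| < e.
Proof.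
split=> [H e e0|H V /nbhs_RP[e e0 eV]].
  have /H /nbhsCP : nbhs l [set y | `|y - l| < e] by apply/nbhs_RP; exists e.
  by [].
by have [d d0 dH] := H e e0; apply/nbhsCP; exists d => // w /dH /eV.
Qed.

Lemma continuous_cabs : continuous (@cabs R).
Proof.
move=> z; apply/cvg_CRP => e e0; exists e => // w wz.
apply: le_lt_trans wz; rewrite ler_norml.
have := cabs_triangle z w 0; have := cabs_triangle w z 0; rewrite !subr0 (cabsC z w).
by rewrite -/(cabs w); move: (cabs w) (cabs z) (cabs (w - z)) => a b c; lra.
Qed.

Lemma continuous_mkc : continuous (fun p : R * R => mkc p.1 p.2).
Proof.
move=> [x y] V /nbhsCP[d d0 dV].
have d2 : 0 < d / 2 by lra.
exists ([set a | `|a - x| < d / 2], [set b | `|b - y| < d / 2]) => /=.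
  by split; apply/nbhs_RP; exists (d / 2).
move=> [a b] [/= ax bx]; apply: dV; apply: le_lt_trans (cabs_le_reim _) _.
by rewrite !reimE; lra.
Qed.

Lemma compact_bounded_closed (K : set C) (M : R) :
  closed K -> (forall z, K z -> cabs z <= M) -> compact K.
Proof.
move=> cK KM.
have cS : compact ((fun p : R * R => mkc p.1 p.2) @` (`[- M, M]%classic `*` `[- M, M]%classic)).
  apply: continuous_compact.
    exact/continuous_subspaceT/continuous_mkc.
  by apply: compact_setX; exact: segment_compact.
apply: subclosed_compact cK cS _ => z /KM zM.
exists (re z, im z); last by case: z {zM}.
by split; rewrite /= in_itv /= -ler_norml; apply: le_trans zM;
  [exact: cabs_ge_re|exact: cabs_ge_im].
Qed.

Lemma closed_cdisc z d : closed (cdisc z d).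
Proof.
rewrite (_ : cdisc z d = (fun w => cabs (w - z)) @^-1` [set x | x <= d]) //.
apply: closed_comp => [w _|]; last exact: closed_le.
apply: (@continuous_comp _ _ _ (fun w => w - z) (@cabs R)).
  by apply/cvg_CP => e e0; exists e => // u; rewrite opprB addrA subrK.
exact: continuous_cabs.
Qed.

Lemma compact_cdisc z d : compact (cdisc z d).
Proof.
apply: (@compact_bounded_closed _ (d + cabs z)); first exact: closed_cdisc.
move=> w; rewrite /cdisc /= => wd.
by have := cabs_triangle z w 0; rewrite !subr0; lra.
Qed.

Lemma compact_maxC (K : set C) (f : C -> R) : K !=set0 -> compact K ->
  (forall z, K z -> {for z, continuous f}) ->
  exists2 p, K p & forall z, K z -> f z <= f p.
Proof.
move=> K0 cK fc.
have [|p pK pM] := @compact_EVT_max _ _ f K K0 cK.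
  by apply: continuous_in_subspaceT => z /set_mem /fc.
by exists p; [exact/set_mem|move=> z zK; apply: pM; exact/mem_set].
Qed.

Lemma compact_boundedC (K : set C) :
  compact K -> exists2 M : R, 0 < M & forall z, K z -> cabs z <= M.
Proof.
move=> cK; have [->|/set0P K0] := eqVneq K set0; first by exists 1.
have [p _ pM] := compact_maxC K0 cK (fun z _ => @continuous_cabs z).
by exists (cabs p + 1) => [|z /pM]; [have := cabs_ge0 p|]; lra.
Qed.

End ComplexPlane.

(** * Second-order expansions and the maximum principle *)

Section Caratheodory.
Variable R : realType.
Local Notation C := (CC R).

Definition cont (f : C -> C) (p : C) : Prop :=
  forall e : R, 0 < e -> exists2 d : R, 0 < d &
    forall w, cabs (w - p) < d -> cabs (f w - f p) < e.

Lemma contP f p : cont f p <-> {for p, continuous f}.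
Proof. by split=> [H|H]; [apply/cvg_CP|move/cvg_CP : H]. Qed.

Lemma cont_cst c p : cont (fun=> c) p.
Proof. by move=> e e0; exists 1 => // w _; rewrite subrr cabs0. Qed.

Lemma cont_id p : cont id p.
Proof. by move=> e e0; exists e. Qed.

Lemma contD f g p : cont f p -> cont g p -> cont (fun z => f z + g z) p.
Proof.
move=> fp gp e e0; have e2 : 0 < e / 2 by lra.
have [d d0 dH] := fp _ e2; have [d' d'0 d'H] := gp _ e2.
exists (Num.min d d'); first by rewrite lt_min d0.
move=> w; rewrite lt_min => /andP[/dH ? /d'H ?].
rewrite (_ : _ - _ = (f w - f p) + (g w - g p)); last by ring.
by apply: le_lt_trans (cabsD _ _) _; lra.
Qed.

Lemma contM f g p : cont f p -> cont g p -> cont (fun z => f z * g z) p.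
Proof.
move=> fp gp e e0.
have F0 := cabs_ge0 (f p); have G0 := cabs_ge0 (g p).
pose M := cabs (f p) + cabs (g p) + 1.
have M0 : 0 < M by rewrite /M; lra.
pose e' := Num.min 1 (e / M).
have e'0 : 0 < e' by rewrite lt_min ltr01 divr_gt0.
have e'1 : e' <= 1 by rewrite ge_min lexx.
have e'M : e' * M <= e by rewrite -ler_pdivlMr// ge_min lexx orbT.
have [d d0 dH] := fp _ e'0; have [d' d'0 d'H] := gp _ e'0.
exists (Num.min d d'); first by rewrite lt_min d0.
move=> w; rewrite lt_min => /andP[/dH fw /d'H gw].
rewrite (_ : _ - _ = (f w - f p) * (g w - g p) + (f w - f p) * g p + f p * (g w - g p));
  last by ring.
apply: le_lt_trans (cabsD _ _) _.
have := cabsD ((f w - f p) * (g w - g p)) ((f w - f p) * g p).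
move: e'M; rewrite !cabsM /M.
have := cabs_ge0 (f w - f p); have := cabs_ge0 (g w - g p).
move: (cabs (f w - f p)) (cabs (g w - g p)) (cabs (_ + _)) (cabs (f p)) (cabs (g p)) fw gw F0 G0
  => x y u F G; nra.
Qed.

Lemma cont_comp f g p : cont f p -> cont g (f p) -> cont (fun z => g (f z)) p.
Proof.
move=> fp gp e /gp[d d0 dH]; have [d' d'0 d'H] := fp _ d0.
by exists d' => // w /d'H /dH.
Qed.

Lemma cont_eq_near f g p (d : R) : 0 < d ->
  (forall w, cabs (w - p) < d -> f w = g w) -> cont g p -> cont f p.
Proof.
move=> d0 fg gp e /gp[d' d'0 d'H].
exists (Num.min d d'); first by rewrite lt_min d0.
move=> w; rewrite lt_min => /andP[wd /d'H].
by rewrite fg// fg// subrr cabs0.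
Qed.

Lemma cont_inv p : p != 0 -> cont (fun z => z^-1) p.
Proof.
move=> p0 e e0; have P0 : 0 < cabs p by rewrite cabs_gt0.
exists (Num.min (cabs p / 2) (e * (cabs p ^+ 2 / 2))).
  by rewrite lt_min; apply/andP; split; rewrite ?mulr_gt0 ?exprn_gt0 ?invr_gt0.
move=> w; rewrite lt_min => /andP[wp we].
have wP : cabs p / 2 < cabs w.
  by have := cabs_triangle w p 0; rewrite !subr0 cabsC; lra.
have w0 : w != 0 by rewrite -cabs_gt0; lra.
rewrite (_ : _ - _ = - (w - p) / (w * p)); last by field; rewrite w0 p0.
rewrite cabsM cabsN cabsV cabsM ltr_pdivrMr; last by rewrite mulr_gt0// cabs_gt0.
apply: lt_le_trans we _; rewrite ler_pM2l// expr2; nra.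
Qed.

(* Second-order Caratheodory differentiability: an exact equation instead of a
   remainder estimate, so that the calculus rules are ring identities. *)
Definition D2 (f : C -> C) (p a : C) (b : C -> C) : Prop :=
  cont b 0 /\ forall h, f (p + h) = f p + a * h + h * h * b h.

Definition smooth2 (f : C -> C) (p : C) : Prop := exists a b, D2 f p a b.

Lemma D2_cst c p : D2 (fun=> c) p 0 (fun=> 0).
Proof. by split=> [|h]; [exact: cont_cst|rewrite mul0r mulr0 !addr0]. Qed.

Lemma D2_id p : D2 id p 1 (fun=> 0).
Proof. by split=> [|h]; [exact: cont_cst|rewrite mul1r mulr0 !addr0]. Qed.

Lemma D2_add f g p a b c d : D2 f p a b -> D2 g p c d ->
  D2 (fun z => f z + g z) p (a + c) (fun h => b h + d h).
Proof.
move=> [bc fE] [dc gE]; split; first exact: contD.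
by move=> h; rewrite fE gE; ring.
Qed.

Lemma D2_mul f g p a b c d : D2 f p a b -> D2 g p c d ->
  D2 (fun z => f z * g z) p (a * g p + f p * c)
   (fun h => f p * d h + a * c + b h * g p + h * (a * d h + b h * c)
             + h * h * (b h * d h)).
Proof.
move=> [bc fE] [dc gE]; split; last by move=> h; rewrite fE gE; ring.
by repeat first [apply: contD|apply: contM|exact: cont_cst|exact: cont_id|by []].
Qed.

Lemma D2_comp f g p a b c d : D2 f p a b -> D2 g (f p) c d ->
  D2 (fun z => g (f z)) p (c * a)
   (fun h => c * b h + (a + h * b h) * (a + h * b h) * d (h * (a + h * b h))).
Proof.
move=> [bc fE] [dc gE]; split; last first.
  move=> h.
  rewrite (_ : f (p + h) = f p + h * (a + h * b h)); last by rewrite fE; ring.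
  by rewrite gE; ring.
have cq : cont (fun h : C => a + h * b h) 0.
  by apply: contD; [exact: cont_cst|apply: contM => //; exact: cont_id].
apply: contD; first by apply: contM => //; exact: cont_cst.
apply: contM; first exact: contM.
apply: (@cont_comp (fun h => h * (a + h * b h)) d).
  by apply: contM => //; exact: cont_id.
by rewrite mul0r.
Qed.

Lemma D2_inv p : p != 0 ->
  exists2 b, b 0 = p^-1 ^+ 3 & D2 (fun z => z^-1) p (- p^-1 ^+ 2) b.
Proof.
move=> p0; have P0 : 0 < cabs p by rewrite cabs_gt0.
(* The expansion must be exact for every [h]. At [h = - p] the inverse takes its default value 0,
   which forces the coefficient -2 / p^3 there; this point is away from 0, so continuity at 0 is
   unaffected. *)
exists (fun h => if h == - p then - 2 * p^-1 ^+ 3 else p^-1 ^+ 2 * (p + h)^-1).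
  by rewrite eq_sym oppr_eq0 (negbTE p0) addr0 !exprS expr0; ring.
split; last first.
  move=> h; case: eqVneq => [->|hp].
    by rewrite subrr invr0; field.
  have hp0 : p + h != 0 by rewrite addrC addr_eq0.
  by field; rewrite hp0 p0.
apply: (@cont_eq_near _ (fun h => p^-1 ^+ 2 * (p + h)^-1) _ (cabs p)) => //.
  by move=> w; rewrite subr0; case: eqVneq => [->|//]; rewrite cabsN ltxx.
apply: contM; first exact: cont_cst.
apply: (@cont_comp (fun h => p + h) (fun z => z^-1)).
  by apply: contD; [exact: cont_cst|exact: cont_id].
by apply: cont_inv; rewrite addr0.
Qed.

Lemma smooth2_cst c p : smooth2 (fun=> c) p.
Proof. by exists 0, (fun=> 0); exact: D2_cst. Qed.

Lemma smooth2_id p : smooth2 id p.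
Proof. by exists 1, (fun=> 0); exact: D2_id. Qed.

Lemma smooth2_add f g p : smooth2 f p -> smooth2 g p ->
  smooth2 (fun z => f z + g z) p.
Proof. by move=> [a [b fp]] [c [d gp]]; do 2 eexists; apply: D2_add fp gp. Qed.

Lemma smooth2_mul f g p : smooth2 f p -> smooth2 g p ->
  smooth2 (fun z => f z * g z) p.
Proof. by move=> [a [b fp]] [c [d gp]]; do 2 eexists; apply: D2_mul fp gp. Qed.

Lemma smooth2_comp f g p : smooth2 f p -> smooth2 g (f p) ->
  smooth2 (fun z => g (f z)) p.
Proof. by move=> [a [b fp]] [c [d gp]]; do 2 eexists; apply: D2_comp fp gp. Qed.

Lemma smooth2_addc f c p : smooth2 f p -> smooth2 (fun z => f z + c) p.
Proof. by move=> fp; apply: smooth2_add => //; exact: smooth2_cst. Qed.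

Lemma smooth2_inv f p : smooth2 f p -> f p != 0 -> smooth2 (fun z => (f z)^-1) p.
Proof.
move=> fp fp0; apply: (smooth2_comp (g := fun z => z^-1) fp).
by have [b _ bD] := D2_inv fp0; exists (- (f p)^-1 ^+ 2), b.
Qed.

Lemma smooth2_cont f p : smooth2 f p -> cont f p.
Proof.
move=> [a [b [bc fE]]].
have H : cont (fun h => f p + a * h + h * h * b h) 0.
  by repeat first [apply: contD|apply: contM|exact: cont_cst|exact: cont_id|by []].
move=> e e0; have [d d0 dH] := H e e0.
exists d => // w wd; rewrite (_ : w = p + (w - p)); last by rewrite addrC subrK.
rewrite fE.
by have := dH (w - p); rewrite subr0 => /(_ wd); rewrite mulr0 !mul0r !addr0.
Qed.

Lemma D2_derivable f p a b : D2 f p a b -> derivable f p 1.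
Proof.
move=> [bc fE]; apply/cvg_ex; exists a => V /nbhsCP[e e0 eV].
have H : cont (fun h => a + h * b h) 0.
  by repeat first [apply: contD|apply: contM|exact: cont_cst|exact: cont_id|by []].
have [d d0 dH] := H _ e0.
apply/nbhsCP; exists d => // h hd h0; apply: eV.
have -> : h^-1 *: ((f \o shift p) (h *: 1) - f p) = a + h * b h.
  by rewrite /= [h *: 1]mulr1 [h + p]addrC fE /GRing.scale /=; field.
by have := dH h hd; rewrite mul0r addr0.
Qed.

End Caratheodory.

Section MaximumPrinciple.
Variable R : realType.
Local Notation C := (CC R).

Definition ii : C := mkc 0 1.

Lemma ii2 : ii * ii = -1.
Proof. by apply: complex_ext; rewrite !reimE; ring. Qed.

Lemma cabs_ii : cabs ii = 1.
Proof. by rewrite cabsE !reimE expr0n expr1n add0r sqrtr1. Qed.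

(* The second-order terms of [phi] cancel on the four points p +- t, p +- it, so
   the strictly convex perturbation [eta |z - q|^2] excludes a maximum at [p]. *)
Lemma no_interior_max (phi : C -> C) (c q p : C) (eta d : R) :
  0 < eta -> 0 < d -> smooth2 phi p ->
  (forall z, disc p d z ->
    re (c * phi z) + eta * cabs (z - q) ^+ 2 <=
    re (c * phi p) + eta * cabs (p - q) ^+ 2) -> False.
Proof.
move=> eta0 d0 [a [b [bc phiE]]] pmax.
have c1 : 0 < 1 + cabs c by have := cabs_ge0 c; lra.
(* With this tolerance the remainder costs less than [eta * t ^+ 2] at each of the four points,
   while the convex term gains exactly [eta * t ^+ 2] on average. *)
have e0 : 0 < eta / (1 + cabs c) by rewrite divr_gt0.
have [r r0 rH] := bc _ e0.
pose t := Num.min (r / 2) (d / 2).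
have t0 : 0 < t by rewrite /t lt_min; apply/andP; split; lra.
have tr : t < r by rewrite /t gt_min; apply/orP; left; lra.
have td : t < d by rewrite /t gt_min; apply/orP; right; lra.
have key h : cabs h = t -> re (c * phi (p + h)) + eta * cabs (p + h - q) ^+ 2 <=
    re (c * phi p) + eta * cabs (p - q) ^+ 2.
  by move=> ht; apply: pmax; rewrite /disc /= addrC addKr ht.
have bb h : cabs h = t ->
    `|re (c * (h * h * (b h - b 0)))| <= t ^+ 2 * (eta * (cabs c / (1 + cabs c))).
  move=> ht; apply: le_trans (cabs_ge_re _) _; rewrite !cabsM ht.
  have := rH h; rewrite subr0 ht => /(_ tr) bh.
  rewrite mulrCA -expr2; apply: ler_wpM2l; first exact: sqr_ge0.
  by rewrite mulrCA ler_wpM2l ?cabs_ge0// ltW.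
have lt1 : cabs c / (1 + cabs c) < 1.
  by rewrite ltr_pdivrMr// mul1r; lra.
have T : cabs (rc t) = t by rewrite cabs_rc ger0_norm// ltW.
have T1 := key (rc t) T.
have T2 := key (- rc t) (etrans (cabsN _) T).
have T' : cabs (ii * rc t) = t by rewrite cabsM cabs_ii mul1r.
have T3 := key (ii * rc t) T'.
have T4 := key (- (ii * rc t)) (etrans (cabsN _) T').
have B1 := bb (rc t) T.
have B2 := bb (- rc t) (etrans (cabsN _) T).
have B3 := bb (ii * rc t) T'.
have B4 := bb (- (ii * rc t)) (etrans (cabsN _) T').
move: T1 T2 T3 T4; rewrite !phiE => T1 T2 T3 T4.
pose x h := c * (h * h * (b h - b 0)).
have E h : c * (phi p + a * h + h * h * b h) =
  c * phi p + c * a * h + c * b 0 * (h * h) + x h by rewrite /x; ring.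
move: T1 T2 T3 T4; rewrite !E.
have S : (c * phi p + c * a * rc t + c * b 0 * (rc t * rc t) + x (rc t)) +
    (c * phi p + c * a * - rc t + c * b 0 * (- rc t * - rc t) + x (- rc t)) +
    (c * phi p + c * a * (ii * rc t) + c * b 0 * (ii * rc t * (ii * rc t))
      + x (ii * rc t)) +
    (c * phi p + c * a * - (ii * rc t)
      + c * b 0 * (- (ii * rc t) * - (ii * rc t)) + x (- (ii * rc t))) =
    c * phi p + c * phi p + c * phi p + c * phi p
    + (x (rc t) + x (- rc t) + x (ii * rc t) + x (- (ii * rc t))).
  have I2 : ii * rc t * (ii * rc t) = - (rc t * rc t).
    by rewrite mulrACA ii2 mulN1r.
  by rewrite !mulrNN I2; ring.
have N : cabs (p + rc t - q) ^+ 2 + cabs (p - rc t - q) ^+ 2 +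
    cabs (p + ii * rc t - q) ^+ 2 + cabs (p - ii * rc t - q) ^+ 2 =
    4 * cabs (p - q) ^+ 2 + 4 * t ^+ 2.
  rewrite -!(addrAC p (- q)); move: (p - q) => u.
  by rewrite !cabs_sqr !reimE; ring.
move/(congr1 (@re R)): S; rewrite !(reD (_ + _ + _ + _)).
rewrite !reD -/(x _) in B1 B2 B3 B4 *.
have K : t ^+ 2 * (eta * (cabs c / (1 + cabs c))) < t ^+ 2 * eta.
  by rewrite expr2 ltr_pM2l ?mulr_gt0// gtr_pMr.
move: B1 B2 B3 B4; rewrite -/(x _) -/(x (- rc t)) -/(x (ii * rc t)) -/(x (- (ii * rc t))).
rewrite !ler_norml => /andP[B1 _] /andP[B2 _] /andP[B3 _] /andP[B4 _].
move: N K B1 B2 B3 B4.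
set Y := t ^+ 2 * (eta * _).
move: (cabs (p + rc t - q) ^+ 2) (cabs (p - rc t - q) ^+ 2)
  (cabs (p + ii * rc t - q) ^+ 2) (cabs (p - ii * rc t - q) ^+ 2)
  (cabs (p - q) ^+ 2) => n1 n2 n3 n4 n0.
move=> N; have {}N : eta * n1 + eta * n2 + eta * n3 + eta * n4 =
    4 * (eta * n0) + 4 * (t ^+ 2 * eta) by rewrite -!mulrDr N; ring.
lra.
Qed.

Lemma cont_re (f : C -> C) p : cont f p -> {for p, continuous (fun z => re (f z))}.
Proof.
move=> fp; apply/cvg_CRP => e /fp[d d0 dH]; exists d => // w /dH.
by apply: le_lt_trans; rewrite -reN -reD cabs_ge_re.
Qed.

Lemma cont_cabs (f : C -> C) p : cont f p -> cont (fun z => rc (cabs (f z))) p.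
Proof.
move=> fp e /fp[d d0 dH]; exists d => // w /dH.
apply: le_lt_trans; rewrite -rcN -rcD cabs_rc ler_norml.
have := cabs_triangle (f p) (f w) 0; have := cabs_triangle (f w) (f p) 0.
rewrite !subr0 (cabsC (f p)); move: (cabs (f w - f p)) (cabs (f w)) (cabs (f p)) => *; lra.
Qed.

(** The part of [K] outside [O] acts as boundary. As [O] is any open subset of [K], a point where
    [phi] is merely continuous can be counted as boundary too. If the bound failed at [q], a
    slightly convex perturbation of a rotated real part would have its maximum over [K] inside
    [O]. *)
Lemma max_principle (K O : set C) (phi : C -> C) (m : R) :
  compact K -> open O -> O `<=` K -> (forall z, O z -> smooth2 phi z) ->
  (forall z, K z -> cont phi z) ->
  (forall z, K z -> ~ O z -> cabs (phi z) <= m) -> 0 <= m ->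
  forall z, K z -> cabs (phi z) <= m.
Proof.
move=> cK oO OK phi2 phic phim m0 q Kq; rewrite leNgt; apply/negP => mq.
have q0 : 0 < cabs (phi q) by lra.
have [M M0 KM] := compact_boundedC cK.
(* The unimodular [c] rotates [phi q] onto the positive axis: the real part of [c * phi] equals the
   modulus at [q] and never exceeds it elsewhere. *)
pose c := rc (cabs (phi q))^-1 * (mkc (re (phi q)) (- im (phi q))).
have c1 : cabs c = 1.
  rewrite cabsM cabs_rc ger0_norm ?invr_ge0 ?cabs_ge0//.
  rewrite [X in _ * X]cabsE !reimE sqrrN -cabsE mulVf// gt_eqF//.
have cq : re (c * phi q) = cabs (phi q).
  rewrite /c !reimE; apply: (@mulfI _ (cabs (phi q))); first by rewrite gt_eqF.
  rewrite -expr2 cabs_sqr; field; by rewrite gt_eqF.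
(* Points of [K] are at most 2M apart, so the perturbation is at most half of the gap between [m]
   and the modulus at [q]. *)
pose eta := (cabs (phi q) - m) / (8 * M ^+ 2).
have M2 : 0 < 8 * M ^+ 2 by rewrite mulr_gt0// exprn_gt0.
have eta0 : 0 < eta by rewrite divr_gt0// subr_gt0.
have etaM : eta * (8 * M ^+ 2) = cabs (phi q) - m.
  by rewrite /eta divfK// gt_eqF.
pose v z := re (c * phi z) + eta * cabs (z - q) ^+ 2.
have [||p Kp pmax] := @compact_maxC _ K v _ cK.
- by exists q.
- move=> z Kz.
  have /cont_re : cont (fun z => c * phi z +
      rc eta * (rc (cabs (z - q)) * rc (cabs (z - q)))) z.
    apply: contD; first by apply: contM; [exact: cont_cst|exact: phic].
    apply: contM; first exact: cont_cst.
    have H : cont (fun z => rc (cabs (z - q))) z.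
      by apply: cont_cabs; apply: contD; [exact: cont_id|exact: cont_cst].
    exact: contM.
  rewrite (_ : (fun w : C => _) = v)//; apply/funext => w.
  by rewrite /v -!rcM reD re_rc expr2.
have vq : v q = cabs (phi q) by rewrite /v subrr cabs0 expr0n mulr0 addr0 cq.
have Op : O p.
  apply: contrapT => nOp; have := pmax q Kq; rewrite vq /v.
  have := phim p Kp nOp.
  have := cabs_ge_re (c * phi p); rewrite cabsM c1 mul1r ler_norml => /andP[_].
  have := cabsB p q; have := KM p Kp; have := KM q Kq.
  have := cabs_ge0 (p - q); have := cabs_ge0 p; have := cabs_ge0 q.
  move: (cabs (p - q)) (cabs p) (cabs q) => x y z z0 y0 x0 zM yM xyz cp pm qp.
  have x2 : x ^+ 2 <= 4 * M ^+ 2 by rewrite !expr2; nra.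
  have := ler_wpM2l (ltW eta0) x2; move: etaM; rewrite !mulrA -!(mulrC _ eta) => *; lra.
have /nbhsCP[d d0 dO] : nbhs p O by exact: open_nbhs_nbhs.
apply: (@no_interior_max phi c q p eta d) => //; first exact: phi2.
by move=> z zd; apply: (pmax z); apply: OK; exact: dO.
Qed.

(* [phi^2 / (z - p)], which is [0] at [p] because of the junk value of the
   inverse, is bounded by [1 / r] on the circle. *)
Lemma weak_schwarz (phi : C -> C) (p : C) (r : R) : 0 < r ->
  (forall z, cdisc p r z -> smooth2 phi z) -> phi p = 0 ->
  (forall z, cdisc p r z -> cabs (phi z) <= 1) ->
  forall z, cdisc p r z -> cabs (phi z) ^+ 2 <= cabs (z - p) / r.
Proof.
move=> r0 phi2 phi0 phi1 z zr.
have [->|zp] := eqVneq z p.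
  by rewrite phi0 subrr cabs0 expr0n mul0r.
have Zp : 0 < cabs (z - p) by rewrite cabs_gt0 subr_eq0.
pose psi z := phi z * phi z * (z - p)^-1.
have cp : cdisc p r p by rewrite /cdisc /= subrr cabs0 ltW.
suff : cabs (psi z) <= r^-1.
  by rewrite /psi !cabsM cabsV ler_pdivrMr// -expr2 [r^-1 * _]mulrC.
have psi2 w : cdisc p r w -> w != p -> smooth2 psi w.
  move=> wr wp; apply: smooth2_mul.
    by apply: smooth2_mul; exact: phi2.
  apply: smooth2_inv; last by rewrite subr_eq0.
  by apply: smooth2_addc; exact: smooth2_id.
(* Removing the centre from the open set makes it a boundary point, where continuity of [psi]
   suffices. Because [phi] is squared, [psi] tends to 0 there, in agreement with its default
   value. *)
apply: (@max_principle (cdisc p r) (disc p r `&` ~` [set p]) psi) => //.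
- exact: compact_cdisc.
- apply: openI; first exact: open_disc.
  rewrite openE => w /eqP; rewrite -subr_eq0 -cabs_gt0 => wp.
  apply/nbhsCP; exists (cabs (w - p)) => // u uw up.
  by move: uw; rewrite up cabsC ltxx.
- by move=> w [/ltW].
- by move=> w [/ltW wr /eqP wp]; exact: psi2.
- move=> w wr; have [->|wp] := eqVneq w p; last exact/smooth2_cont/psi2.
  have [a [b [bc phiE]]] := phi2 p cp.
  have H : cont (fun h => h * (a + h * b h) * (a + h * b h)) 0.
    by repeat first [apply: contD|apply: contM|exact: cont_cst|exact: cont_id|by []].
  move=> e e0; have [d d0 dH] := H _ e0; exists d => // u ud.
  have := dH (u - p); rewrite !mul0r !subr0 => /(_ ud).
  rewrite /psi subrr invr0 mulr0 subr0; congr (cabs _ < e).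
  have -> : phi u = (u - p) * (a + (u - p) * b (u - p)).
    by rewrite -[in LHS](subrK p u) [in LHS]addrC phiE phi0; ring.
  have [->|up] := eqVneq u p; first by rewrite subrr invr0; ring.
  by field; rewrite subr_eq0.
- move=> w wr nO; have [->|wp] := eqVneq w p.
    by rewrite /psi subrr invr0 mulr0 cabs0 invr_ge0 ltW.
  have wE : cabs (w - p) = r.
    apply/eqP; rewrite eq_le wr /= leNgt; apply/negP => wr'.
    by apply: nO; split => //; exact/eqP.
  rewrite /psi !cabsM cabsV wE ler_piMl ?invr_ge0 ?(ltW r0)//.
  by rewrite mulr_ile1 ?cabs_ge0// phi1.
- by rewrite invr_ge0 ltW.
Qed.

(** The Cayley transform (G - P) / (G + conj P), with P = G(p), maps the right half-plane to the
    disc and vanishes at [p]. By [weak_schwarz] its squared modulus is at most 1/4 on the smaller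
    disc, so 4 Re G Re P >= 3/4 (Re G + Re P)^2 >= 3/4 (Re P)^2, whence 3/16. *)
Lemma weak_harnack (G : C -> C) (p : C) (r : R) : 0 < r ->
  (forall z, cdisc p r z -> smooth2 G z) ->
  (forall z, cdisc p r z -> 0 < re (G z)) ->
  forall z, cdisc p (r / 4) z -> 3 / 16 * re (G p) <= re (G z).
Proof.
move=> r0 G2 G0 z zr.
have zr' : cdisc p r z by apply: le_trans zr _; lra.
have cp : cdisc p r p by rewrite /cdisc /= subrr cabs0 ltW.
pose P := G p; pose Pb : C := mkc (re P) (- im P).
have P0 : 0 < re P := G0 p cp.
have rPb : re Pb = re P by [].
have D0 w : cdisc p r w -> 0 < re (G w + Pb).
  by move=> /G0; rewrite !reimE; lra.
have nz (u : C) : 0 < re u -> u != 0.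
  by move=> u0; apply/eqP => u0'; move: u0; rewrite u0' re0 ltxx.
pose phi w := (G w - P) * (G w + Pb)^-1.
have nE (w : C) : cabs (w - P) ^+ 2 = cabs (w + Pb) ^+ 2 - 4 * re w * re P.
  by rewrite !cabs_sqr /Pb !reimE; ring.
have phiE w : cdisc p r w ->
    cabs (phi w) ^+ 2 * cabs (G w + Pb) ^+ 2 = cabs (G w - P) ^+ 2.
  move=> /D0/nz; rewrite -cabs_gt0 => w0.
  by rewrite /phi cabsM cabsV exprMn exprVn divfK// expf_neq0// gt_eqF.
have phi1 w : cdisc p r w -> cabs (phi w) <= 1.
  move=> wr; rewrite -(@ler_pXn2r _ 2) ?nnegrE ?cabs_ge0 ?ler01// expr1n.
  have w0 := nz _ (D0 w wr); rewrite -cabs_gt0 in w0.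
  rewrite -(@ler_pM2r _ (cabs (G w + Pb) ^+ 2)) ?exprn_gt0// phiE// nE mul1r.
  by have := G0 w wr; nra.
have phi2 w : cdisc p r w -> smooth2 phi w.
  move=> wr; apply: smooth2_mul; first by apply: smooth2_addc; exact: G2.
  apply: smooth2_inv; first by apply: smooth2_addc; exact: G2.
  exact: nz (D0 w wr).
have phi0 : phi p = 0 by rewrite /phi subrr mul0r.
have := weak_schwarz r0 phi2 phi0 phi1 zr'.
have zr4 : cabs (z - p) / r <= 1 / 4.
  by rewrite ler_pdivrMr//; move: zr; rewrite /cdisc /=; lra.
move=> /le_trans => /(_ _ zr4) H.
have := phiE z zr'; rewrite nE.
have : re (G z + Pb) ^+ 2 <= cabs (G z + Pb) ^+ 2.
  by rewrite cabs_sqr lerDl sqr_ge0.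
rewrite reD rPb; have := G0 z zr'.
have := sqr_ge0 (cabs (G z + Pb)).
rewrite -/P; move: (re (G z)) (re P) P0 (cabs (phi z) ^+ 2) H (cabs (G z + Pb) ^+ 2) => g q *.
nra.
Qed.

End MaximumPrinciple.

(** * Mean value inequality, power series, exponential and Ein *)

Section MeanValue.
Variable R : realType.
Local Notation C := (CC R).

Lemma is_derive_quadratic (f : R -> R) (t l M d : R) : 0 < d -> 0 <= M ->
  (forall h, `|h| < d -> `|f (t + h) - f t - l * h| <= M * h ^+ 2) ->
  is_derive t 1 f l.
Proof.
move=> d0 M0 H.
have cv : h^-1 *: ((f \o shift t) (h *: 1) - f t) @[h --> (0 : R)^'] --> l.
  move=> V /nbhs_RP[e e0 eV].
  have e1 : 0 < e / (M + 1) by rewrite divr_gt0// ltr_wpDl.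
  apply/nbhs_RP; exists (Num.min d (e / (M + 1))); first by rewrite lt_min d0.
  move=> h; rewrite subr0 lt_min => /andP[hd he] h0; apply: eV.
  have n0 : 0 < `|h| by rewrite normr_gt0.
  have -> : h^-1 *: ((f \o shift t) (h *: 1) - f t) - l =
      (f (t + h) - f t - l * h) / h.
    by rewrite /= [h *: 1]mulr1 [h + t]addrC /GRing.scale /=; field.
  rewrite normrM normfV ltr_pdivrMr//; apply: le_lt_trans (H h hd) _.
  rewrite -real_normK ?num_real// expr2 mulrA ltr_pM2r//.
  move: he; rewrite ltr_pdivlMr ?ltr_wpDl//; nra.
apply: DeriveDef; first by apply/cvg_ex; exists l.
exact: cvg_lim cv.
Qed.

Lemma D2_is_derive (f : C -> C) (c z w a : C) (b : C -> C) (t : R) :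
  D2 f (z + rc t * w) a b ->
  is_derive t 1 (fun t => re (c * f (z + rc t * w))) (re (c * (a * w))).
Proof.
move=> [bc fE].
have [d d0 dH] := bc 1 ltr01.
pose W := cabs w + 1; have W0 : 0 < W by rewrite /W ltr_wpDl// cabs_ge0.
apply: (@is_derive_quadratic _ _ _ (cabs c * cabs w ^+ 2 * (cabs (b 0) + 1)) (d / W)).
- by rewrite divr_gt0.
- by rewrite !mulr_ge0 ?exprn_ge0 ?addr_ge0 ?cabs_ge0.
- move=> h; rewrite ltr_pdivlMr// => hd.
have -> : z + rc (t + h) * w = z + rc t * w + rc h * w by rewrite rcD; ring.
rewrite fE.
have -> : re (c * (f (z + rc t * w) + a * (rc h * w) + rc h * w * (rc h * w) * b (rc h * w)))
   - re (c * f (z + rc t * w)) - re (c * (a * w)) * h =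
   re (c * (rc h * w * (rc h * w) * b (rc h * w))).
  by rewrite !mulrDr !reD; rewrite !reimE; ring.
apply: le_trans (cabs_ge_re _) _.
have hw : cabs (rc h * w) < d.
  rewrite cabsM cabs_rc; apply: le_lt_trans hd; apply: ler_wpM2l => //.
  by rewrite /W; lra.
have bb : cabs (b (rc h * w)) <= cabs (b 0) + 1.
  have := dH (rc h * w); rewrite subr0 => /(_ hw).
  by have := cabs_triangle (b 0) (b (rc h * w)) 0; rewrite !subr0; lra.
rewrite !cabsM cabs_rc -(real_normK (num_real h)).
rewrite (_ : cabs c * cabs w ^+ 2 * (cabs (b 0) + 1) * `|h| ^+ 2 =
  cabs c * (`|h| * cabs w * (`|h| * cabs w)) * (cabs (b 0) + 1)); last by ring.
by rewrite mulrA ler_wpM2l// !mulr_ge0 ?cabs_ge0.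
Qed.

(** Multiplying [f] by the conjugate of its increment [u] and taking real parts gives a real
    function on [0, 1] whose increment is |u|^2, to which the real mean value theorem applies. *)
Lemma segment_mean_value (f df : C -> C) (z w : C) (K : R) :
  (forall t : R, 0 <= t <= 1 ->
    exists b, D2 f (z + rc t * w) (df (z + rc t * w)) b) ->
  (forall t : R, 0 <= t <= 1 -> cabs (df (z + rc t * w) * w) <= K) ->
  cabs (f (z + w) - f z) <= K.
Proof.
move=> fD dfK.
pose u := f (z + w) - f z; pose c : C := mkc (re u) (- im u).
have ca : cabs c = cabs u by rewrite !cabsE !reimE sqrrN.
pose g t := re (c * f (z + rc t * w)).
pose g' t := re (c * (df (z + rc t * w) * w)).
have gD (t : R) : t \in `[0, 1]%R -> is_derive t 1 g (g' t).
  rewrite in_itv /= => t01; have [b bD] := fD t t01; exact: D2_is_derive bD.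
have gc : {within `[0, 1], continuous g}.
  by apply: derivable_within_continuous => t t01; have [] := gD t t01.
have gD' (t : R) : t \in `]0, 1[%R -> is_derive t 1 g (g' t).
  by move=> t01; apply: gD; exact: subset_itv_oo_cc.
have [t t01] := @MVT_segment R g g' 0 1 ler01 gD' gc.
rewrite subr0 mulr1 /g /g' -reN -reD -mulrN -mulrDr rc1 mul1r rc0 mul0r addr0 -/u.
have -> : re (c * u) = cabs u ^+ 2 by rewrite cabs_sqr !reimE; ring.
move=> E; rewrite in_itv /= in t01.
have : cabs u ^+ 2 <= cabs u * K.
  rewrite E; apply: le_trans (ler_norm _) _; apply: le_trans (cabs_ge_re _) _.
  by rewrite cabsM ca ler_wpM2l ?cabs_ge0// dfK.
rewrite -/u; have [->|u0] := eqVneq (cabs u) 0.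
  by move=> _; have := dfK 0; rewrite lexx ler01 => /(_ isT) /(le_trans (cabs_ge0 _)).
by rewrite expr2 ler_pM2l// lt_def u0 cabs_ge0.
Qed.

Lemma D2_eq (f : C -> C) (p a a' : C) b : D2 f p a b -> a = a' -> D2 f p a' b.
Proof. by move=> ? <-. Qed.

(** A cubic error divided by h^2 tends to 0, so the second-order quotient extends continuously by
    [b0]. This is how power series acquire their expansions. *)
Lemma D2_of_cubic (f : C -> C) (p a b0 : C) (B : R) :
  (forall h, cabs h <= 1 ->
    cabs (f (p + h) - f p - a * h - b0 * (h * h)) <= B * cabs h ^+ 3) ->
  exists2 b, b 0 = b0 & D2 f p a b.
Proof.
move=> H.
exists (fun h => if h == 0 then b0 else (f (p + h) - f p - a * h) / (h * h)).
  by rewrite eqxx.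
split; last first.
  move=> h; case: eqVneq => [->|h0]; last by field.
  by rewrite addr0 mulr0 !mul0r !addr0.
move=> e e0; rewrite eqxx.
have B1 : 0 < `|B| + 1 by rewrite ltr_wpDl.
exists (Num.min 1 (e / (`|B| + 1))); first by rewrite lt_min ltr01 divr_gt0.
move=> h; rewrite subr0 lt_min => /andP[h1]; rewrite ltr_pdivlMr// => he.
case: eqVneq => [_|h0]; first by rewrite subrr cabs0.
have -> : (f (p + h) - f p - a * h) / (h * h) - b0 =
   (f (p + h) - f p - a * h - b0 * (h * h)) / (h * h) by field.
have n0 : 0 < cabs h by rewrite cabs_gt0.
rewrite cabsM cabsV cabsM ltr_pdivrMr ?mulr_gt0//.
apply: le_lt_trans (H h (ltW h1)) _.
rewrite exprS expr2 mulrA ltr_pM2r ?mulr_gt0//.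
have := ler_norm B; nra.
Qed.

End MeanValue.

(** * Entire power series with factorially decaying coefficients *)

Section PowerSeries.
Variable R : realType.
Local Notation C := (CC R).

Definition clim (u : nat -> C) (l : C) : Prop :=
  forall e : R, 0 < e -> exists N, forall n, (N <= n)%N -> cabs (u n - l) < e.

Lemma clim_unique u l l' : clim u l -> clim u l' -> l = l'.
Proof.
move=> ul ul'; apply/eqP; rewrite -subr_eq0 -cabs_eq0; apply/negPn/negP => n0.
have p0 : 0 < cabs (l - l') / 2 by rewrite divr_gt0// lt_def n0 cabs_ge0.
have [N NH] := ul _ p0; have [N' NH'] := ul' _ p0.
have := NH (maxn N N') (leq_maxl _ _); have := NH' (maxn N N') (leq_maxr _ _).
have := cabs_triangle (u (maxn N N')) l l'; rewrite (cabsC l (u _)); lra.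
Qed.

Lemma clim_le u l (B : R) : (forall n, cabs (u n) <= B) -> clim u l -> cabs l <= B.
Proof.
move=> uB ul; rewrite leNgt; apply/negP => Bl.
have p0 : 0 < cabs l - B by rewrite subr_gt0.
have [N /(_ N (leqnn _))] := ul _ p0.
by have := uB N; have := cabs_triangle (u N) l 0; rewrite !subr0 (cabsC l); lra.
Qed.

Lemma climD u v l m : clim u l -> clim v m -> clim (fun n => u n + v n) (l + m).
Proof.
move=> ul vm e e0; have e2 : 0 < e / 2 by rewrite divr_gt0.
have [N NH] := ul _ e2; have [N' NH'] := vm _ e2.
exists (maxn N N') => n; rewrite geq_max => /andP[/NH ? /NH' ?].
rewrite (_ : _ - _ = (u n - l) + (v n - m)); last by ring.
by apply: le_lt_trans (cabsD _ _) _; lra.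
Qed.

Lemma climZ c u l : clim u l -> clim (fun n => c * u n) (c * l).
Proof.
move=> ul e e0; have c1 : 0 < cabs c + 1 by rewrite ltr_wpDl// cabs_ge0.
have [N NH] := ul _ (divr_gt0 e0 c1); exists N => n /NH.
rewrite -mulrBr cabsM ltr_pdivlMr// => H; apply: le_lt_trans H.
by have := cabs_ge0 (u n - l); nra.
Qed.

Lemma clim_shift u l : clim u l -> clim (fun n => u n.+1) l.
Proof. by move=> ul e /ul[N NH]; exists N => n Nn; apply: NH; exact: leqW. Qed.

Lemma clim_reim (u : nat -> C) (a b : R) :
  (fun n => re (u n)) @ \oo --> a -> (fun n => im (u n)) @ \oo --> b ->
  clim u (mkc a b).
Proof.
move=> ua ub e e0; have e2 : 0 < e / 2 by rewrite divr_gt0.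
have [N _ NH] := (cvgrPdist_lt _ _).1 ua _ e2.
have [N' _ NH'] := (cvgrPdist_lt _ _).1 ub _ e2.
exists (maxn N N') => n; rewrite geq_max => /andP[/NH /= H /NH' /= H'].
apply: le_lt_trans (cabs_le_reim _) _.
by rewrite !reimE distrC [X in _ + X]distrC; lra.
Qed.

Definition psum (c : nat -> C) (z : C) (n : nat) : C := \sum_(k < n) c k * z ^+ k.

Fact pser_key : unit. Proof. by []. Qed.

(* Locked, because unification would otherwise unfold power series into their
   real and imaginary parts. *)
Definition pser : (nat -> C) -> C -> C := locked_with pser_key (fun c z =>
  mkc (limn (fun n => re (psum c z n))) (limn (fun n => im (psum c z n)))).

(** This bound survives termwise differentiation with the same [M], and both exp and Ein satisfy it
    with [M = 1]. *)
Definition exp_type (M : R) (c : nat -> C) : Prop :=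
  forall k, cabs (c k) <= M * (k`!%:R)^-1.

Lemma psumS c z n : psum c z n.+1 = psum c z n + c n * z ^+ n.
Proof. by rewrite /psum big_ord_recr. Qed.

Lemma psum_cvg M c z : exp_type M c -> clim (psum c z) (pser c z).
Proof.
move=> cM.
have H (g : C -> R) : (forall w, `|g w| <= cabs w) ->
    cvgn (series (fun k => g (c k * z ^+ k))).
  move=> gb; apply: normed_cvg.
  apply: (@series_le_cvg _ _ (fun k => M * exp_coeff (cabs z) k)) => [k|k|k|].
  - exact: normr_ge0.
  - rewrite mulr_ge0//; last by rewrite /exp_coeff /= mulr_ge0 ?exprn_ge0 ?cabs_ge0.
    by have := cM 0%N; rewrite fact0 invr1 mulr1; apply: le_trans; exact: cabs_ge0.
  - apply: le_trans (gb _) _; rewrite cabsM cabsX /exp_coeff /=.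
    by rewrite [_ / _]mulrC mulrA ler_wpM2r ?exprn_ge0 ?cabs_ge0//.
  - by apply: is_cvg_seriesZ; exact: is_cvg_series_exp_coeff.
have E (g : C -> R) : g 0 = 0 -> (forall u v, g (u + v) = g u + g v) ->
   series (fun k => g (c k * z ^+ k)) = (fun n => g (psum c z n)).
  move=> g0 gD; apply/funext; elim=> [|n IH].
    by rewrite /series /= big_geq// /psum big_ord0.
  by rewrite psumS gD -IH /series /= big_nat_recr.
rewrite [pser]unlock; apply: clim_reim.
  by have := H _ (@cabs_ge_re _); rewrite (E _ (@re0 R) (@reD R)).
by have := H _ (@cabs_ge_im _); rewrite (E _ (@im0 R) (@imD R)).
Qed.

Definition dcoef (c : nat -> C) (k : nat) : C := k.+1%:R * c k.+1.

Lemma cabs_nat n : cabs (n%:R : C) = n%:R.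
Proof.
have -> : (n%:R : C) = rc n%:R.
  by elim: n => // n IH; rewrite -!natr1 IH rcD.
by rewrite cabs_rc ger0_norm.
Qed.

Lemma exp_type_dcoef M c : exp_type M c -> exp_type M (dcoef c).
Proof.
move=> cM k; rewrite cabsM cabs_nat.
apply: le_trans (ler_wpM2l _ (cM k.+1)) _ => //.
rewrite le_eqVlt; apply/orP; left; apply/eqP; rewrite factS natrM; field.
by rewrite nat1r !pnatr_eq0 -lt0n fact_gt0.
Qed.

(** [s k] is the third-order Taylor remainder of the power k + 2, divided by h^3. Starting at
    exponent 2 avoids truncated subtractions in the exponents. *)
Lemma power_expansion (z h : C) (rho : R) :
  1 <= rho -> cabs z <= rho -> cabs (z + h) <= rho ->
  exists2 s : nat -> C, forall k, cabs (s k) <= (4 * rho) ^+ k &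
  forall k, (z + h) ^+ k.+2 = z ^+ k.+2 + k.+2%:R * z ^+ k.+1 * h
     + k.+2%:R * k.+1%:R / 2 * z ^+ k * (h * h) + h * h * h * s k.
Proof.
move=> rho1 zr zhr.
(* Multiplying the expansion of (z + h)^(k+2) by z + h gives this recursion. The binomial factor is
   at most 3^k, so the step is bounded by rho (4 rho)^k + (3 rho)^k, which [1 <= rho] keeps below (4
   rho)^(k+1). *)
pose s := fix s k := if k is k'.+1 then
  (z + h) * s k' + k'.+2%:R * k'.+1%:R / 2 * z ^+ k' else 0.
have T k : (k.+2%:R * k.+1%:R / 2 : R) <= 3 ^+ k.
  elim: k => [|k IH]; first by rewrite expr0; lra.
  have k0 : 0 <= (k%:R : R) by [].
  rewrite exprS; move: IH.
  rewrite -(natr1 k.+2) -(natr1 k.+1) -(natr1 k).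
  move: (3 ^+ k) (k%:R : R) k0 => x y; nra.
exists s; elim=> [|k IH].
- by rewrite /= cabs0 expr0.
- rewrite /=; apply: le_trans (cabsD _ _) _; rewrite !cabsM cabsV !cabs_nat cabsX.
  rewrite exprS.
  have P : 0 <= rho ^+ k by rewrite exprn_ge0// (le_trans ler01).
  have A : cabs (z + h) * cabs (s k) <= rho * (4 * rho) ^+ k.
    by apply: ler_pM => //; exact: cabs_ge0.
  have B : k.+2%:R * k.+1%:R / 2 * cabs z ^+ k <= (3 * rho) ^+ k.
    rewrite exprMn; apply: ler_pM => //.
    - by rewrite exprn_ge0// cabs_ge0.
    - by rewrite lerXn2r// ?nnegrE ?cabs_ge0//; lra.
  have D : (3 * rho) ^+ k <= (4 * rho) ^+ k by rewrite lerXn2r// ?nnegrE; lra.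
  have : 0 <= (4 * rho) ^+ k by rewrite exprn_ge0//; lra.
  move: A B D; move: ((3 * rho) ^+ k) ((4 * rho) ^+ k) => x y.
  nra.
- by rewrite /= expr2 !expr1 expr0 ; field.
- by rewrite exprSr IH /= !exprS -!natr1; field.
Qed.

Lemma series_exp_coeff_bounded (x : R) : 0 <= x ->
  exists B : R, forall n, \sum_(k < n) x ^+ k / k`!%:R <= B.
Proof.
move=> x0; exists (expR x) => n.
rewrite /expR -(big_mkord xpredT (fun k => x ^+ k / k`!%:R)).
apply: (nondecreasing_cvgn_le (u_ := series (exp_coeff x))).
  by apply: nondecreasing_series => k _ _; rewrite /exp_coeff /= mulr_ge0 ?exprn_ge0.
exact: is_cvg_series_exp_coeff.
Qed.

(** Termwise second-order expansion leaves h^3 times the sum of the c_(k+2) s_k, which is dominated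
    by [M] times the exponential series at 4 rho. *)
Lemma pser_D2 M c z : exp_type M c ->
  exists2 b, b 0 = pser (dcoef (dcoef c)) z / 2 &
    D2 (pser c) z (pser (dcoef c) z) b.
Proof.
move=> cM; have M0 : 0 <= M.
  by have := cM 0%N; rewrite fact0 invr1 mulr1; apply: le_trans; exact: cabs_ge0.
pose rho := cabs z + 1.
have rho1 : 1 <= rho by rewrite /rho lerDr cabs_ge0.
have [B BH] : exists B : R, forall n, \sum_(k < n) (4 * rho) ^+ k / k`!%:R <= B.
  by apply: series_exp_coeff_bounded; lra.
apply: (@D2_of_cubic _ _ _ _ _ (M * B)) => h h1.
have zr : cabs z <= rho by rewrite /rho; lra.
have zhr : cabs (z + h) <= rho by have := cabsD z h; rewrite /rho; lra.
have [s sB sE] := power_expansion rho1 zr zhr.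
(* The lengths n + 2, n + 1 and n are those of one truncated polynomial and its first two
   derivatives, which makes the identity exact. *)
have E n : psum c (z + h) n.+2 - psum c z n.+2 - psum (dcoef c) z n.+1 * h -
    psum (dcoef (dcoef c)) z n / 2 * (h * h) =
    h * h * h * \sum_(k < n) c k.+2 * s k.
  elim: n => [|n IH].
    rewrite big_ord0 /psum !(big_ord_recr, big_ord0) /= /dcoef.
    by rewrite !expr0 !expr1; ring.
  rewrite big_ord_recr mulrDr -IH (psumS c (z + h) n.+2) (psumS c z n.+2).
  rewrite (psumS (dcoef c) z n.+1) (psumS (dcoef (dcoef c)) z n) sE /dcoef /=.
  by field.
have L : clim (fun n => psum c (z + h) n.+2 - psum c z n.+2 - psum (dcoef c) z n.+1 * h -
    psum (dcoef (dcoef c)) z n / 2 * (h * h))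
    (pser c (z + h) - pser c z - pser (dcoef c) z * h
     - pser (dcoef (dcoef c)) z / 2 * (h * h)).
  have L0 w := psum_cvg w cM.
  have L1 w := psum_cvg w (exp_type_dcoef cM).
  have L2 w := psum_cvg w (exp_type_dcoef (exp_type_dcoef cM)).
  have LN u l k : clim u l -> clim (fun n => - (u n * k)) (- (l * k)).
    move=> /(climZ (- k)); rewrite mulNr mulrC => H e /H[N NH]; exists N => n /NH.
    by rewrite mulNr [k * _]mulrC.
  apply: climD; last first.
    move=> e /(LN _ _ (2^-1 * (h * h)) (L2 z))[N NH]; exists N => n /NH.
    by rewrite !mulrA.
  apply: climD; last by apply: LN; apply: clim_shift.
  apply: climD; first exact: (clim_shift (clim_shift (L0 (z + h)))).
  have := LN _ _ 1 (clim_shift (clim_shift (L0 z))).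
  by rewrite mulr1 => H e /H[N NH]; exists N => n /NH; rewrite mulr1.
apply: clim_le L => n; rewrite E !cabsM mulrC.
have -> : cabs h * cabs h * cabs h = cabs h ^+ 3 by ring.
rewrite ler_wpM2r ?exprn_ge0 ?cabs_ge0//.
apply: (@le_trans _ _ (\sum_(k < n) M * ((4 * rho) ^+ k / k`!%:R))); last first.
  by rewrite -mulr_sumr ler_wpM2l.
elim: n {E} => [|n IH]; first by rewrite !big_ord0 cabs0.
rewrite !big_ord_recr /=; apply: le_trans (cabsD _ _) _; apply: lerD => //.
rewrite cabsM [_ / _]mulrC mulrA; apply: ler_pM; rewrite ?cabs_ge0//.
apply: le_trans (cM _) _; rewrite ler_wpM2l// lef_pV2 ?posrE ?ltr0n ?fact_gt0//.
by rewrite ler_nat !factS mulnA leq_pmull.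
Qed.

End PowerSeries.

Section Exponential.
Variable R : realType.
Local Notation C := (CC R).

Definition exp_c (k : nat) : C := (k`!%:R)^-1.
Definition cexp : C -> C := pser exp_c.

Lemma exp_type_exp : exp_type 1 exp_c.
Proof. by move=> k; rewrite /exp_c cabsV cabs_nat mul1r. Qed.

Lemma dcoef_exp : dcoef exp_c = exp_c.
Proof.
apply/funext => k; rewrite /dcoef /exp_c factS natrM; field.
by rewrite nat1r !pnatr_eq0 -lt0n fact_gt0.
Qed.

Lemma cexp_D2 z : exists2 b, b 0 = cexp z / 2 & D2 cexp z (cexp z) b.
Proof. by have := pser_D2 z exp_type_exp; rewrite !dcoef_exp. Qed.

Lemma psum0 (c : nat -> C) n : psum c 0 n.+1 = c 0%N.
Proof.
elim: n => [|n IH]; first by rewrite psumS /psum big_ord0 expr0; ring.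
by rewrite psumS IH expr0n mulr0 addr0.
Qed.

Lemma pser0 M (c : nat -> C) : exp_type M c -> pser c 0 = c 0%N.
Proof.
move=> cM; apply: (clim_unique (clim_shift (psum_cvg 0 cM))).
by move=> e e0; exists 0%N => n _; rewrite psum0 subrr cabs0.
Qed.

Lemma cexp0 : cexp 0 = 1.
Proof. by rewrite /cexp (pser0 exp_type_exp) /exp_c fact0 invr1. Qed.

(* [cexp u * cexp (z + w - u)] has derivative zero in [u]. *)
Lemma cexpD z w : cexp (z + w) = cexp z * cexp w.
Proof.
pose F u := cexp u * cexp (z + w - u).
have FD u : exists b, D2 F u 0 b.
  have [b _ bD] := cexp_D2 u.
  have [b' _ b'D] := cexp_D2 (z + w - u).
  have D : D2 (fun u => z + w - u) u (- 1) (fun=> 0).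
    split=> [|h]; first exact: cont_cst.
    by ring.
  have := D2_mul bD (D2_comp D b'D) => D'.
  have E : cexp u * cexp (z + w - u) + cexp u * (cexp (z + w - u) * -1) = 0.
    by move: (cexp u) (cexp _) => x y; rewrite mulrN1 mulrN subrr.
  exact (ex_intro _ _ (D2_eq D' E)).
have : cabs (F (0 + z) - F 0) <= 0.
  apply: (@segment_mean_value _ F (fun=> 0)) => t _; first exact: FD.
  by rewrite mul0r cabs0.
rewrite add0r => H; have : F z - F 0 == 0.
  by rewrite -cabs_eq0 eq_le H cabs_ge0.
rewrite subr_eq0 /F cexp0 mul1r subr0 => /eqP <-.
by rewrite addrAC subrr add0r.
Qed.

Lemma cexp_rc (x : R) : cexp (rc x) = rc (expR x).
Proof.
apply: (clim_unique (psum_cvg (rc x) exp_type_exp)) => e e0.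
have := @is_cvg_series_exp_coeff R x => /cvgrPdist_lt /(_ _ e0)[N _ NH].
exists N => n /NH /=.
have -> : psum exp_c (rc x) n = rc (series (exp_coeff x) n).
  elim: n => [|n IH]; first by rewrite /psum big_ord0 /series /= big_geq.
  rewrite psumS IH /series /= big_nat_recr//= rcD /exp_coeff /= rcM rcX mulrC.
  congr (_ + _ * _); rewrite /exp_c.
  have N0 : (n`!%:R : R) != 0 by rewrite pnatr_eq0 -lt0n fact_gt0.
  have -> : (n`!%:R : C) = rc n`!%:R.
    by elim: (n`!) => // m IHm; rewrite -!natr1 IHm rcD.
  apply: (@mulfI _ (rc n`!%:R)); first by rewrite -cabs_eq0 cabs_rc normr_eq0.
  by rewrite -rcM !divff// -cabs_eq0 cabs_rc normr_eq0.
by rewrite -rcN -rcD cabs_rc distrC.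
Qed.

Definition cj (z : C) : C := mkc (re z) (- im z).

Lemma cjM z w : cj (z * w) = cj z * cj w.
Proof. by apply: complex_ext; rewrite !reimE; ring. Qed.
Lemma cjD z w : cj (z + w) = cj z + cj w.
Proof. by apply: complex_ext; rewrite !reimE; ring. Qed.
Lemma cabs_cj z : cabs (cj z) = cabs z.
Proof. by rewrite !cabsE !reimE sqrrN. Qed.

Lemma pser_cj M (c : nat -> C) z : exp_type M c -> (forall k, cj (c k) = c k) ->
  pser c (cj z) = cj (pser c z).
Proof.
move=> cM cr; apply: (clim_unique (psum_cvg (cj z) cM)) => e e0.
have [N NH] := psum_cvg z cM e0; exists N => n /NH.
rewrite -cabs_cj; congr (cabs _ < e).
have cjN w : cj (- w) = - cj w by apply: complex_ext; rewrite !reimE.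
rewrite cjD cjN; congr (_ - _).
elim: n => [|n IH]; first by rewrite /psum !big_ord0; apply: complex_ext; rewrite !reimE ?oppr0.
rewrite !psumS cjD IH cjM cr; congr (_ + _ * _).
elim: n {IH} => [|n IH]; first by rewrite !expr0; apply: complex_ext; rewrite !reimE ?oppr0.
by rewrite !exprS cjM IH.
Qed.

Lemma cj_rat n : cj ((n%:R)^-1 : C) = n%:R^-1.
Proof.
apply: complex_ext; rewrite /cj !reimE//.
have -> : (n%:R : C) = rc n%:R.
  by elim: n => // m IHm; rewrite -!natr1 IHm rcD.
have -> : ((rc n%:R)^-1 : C) = rc (n%:R)^-1.
  have [->|n0] := eqVneq n 0%N; first by rewrite rc0 !invr0.
  have N0 : (n%:R : R) != 0 by rewrite pnatr_eq0.
  have N0' : rc (n%:R : R) != 0 by rewrite -cabs_eq0 cabs_rc normr_eq0.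
  by apply: (mulfI N0'); rewrite -rcM !divff.
by rewrite !reimE oppr0.
Qed.

(** Since exp has real coefficients, |e^z|^2 is e^z times e^(conj z), that is, e^(2 Re z). *)
Lemma cabs_cexp z : cabs (cexp z) = expR (re z).
Proof.
apply/eqP; rewrite -(@eqrXn2 _ 2) ?cabs_ge0 ?expR_ge0//; apply/eqP.
have -> : cabs (cexp z) ^+ 2 = re (cexp z * cj (cexp z)).
  by rewrite cabs_sqr !reimE; ring.
rewrite -(pser_cj z exp_type_exp); last by move=> k; exact: cj_rat.
rewrite -cexpD (_ : z + cj z = rc (re z + re z)); last first.
  by apply: complex_ext; rewrite !reimE; ring.
by rewrite cexp_rc re_rc expRD expr2.
Qed.

Lemma cexp_neq0 z : cexp z != 0.
Proof. by rewrite -cabs_gt0 cabs_cexp expR_gt0. Qed.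

End Exponential.

(** * The entire function Ein *)

Section EntireLog.
Variable R : realType.
Local Notation C := (CC R).

Definition ein_c (k : nat) : C :=
  if k is k'.+1 then (-1) ^+ k' / (k%:R * k`!%:R) else 0.

(* Ein(z) = int_0^z (1 - e^(-t)) / t dt *)
Definition ein : C -> C := pser ein_c.
Definition ein' : C -> C := pser (dcoef ein_c).

Lemma exp_type_ein : exp_type 1 ein_c.
Proof.
move=> [|k]; first by rewrite cabs0 mul1r invr_ge0.
rewrite /ein_c cabsM cabsX cabsN cabs1 expr1n !mul1r cabsV cabsM !cabs_nat.
rewrite lef_pV2 ?posrE ?mulr_gt0 ?ltr0n ?fact_gt0//.
by rewrite ler_peMl// ler1n.
Qed.

Lemma ein_D2 z : exists2 b, b 0 = pser (dcoef (dcoef ein_c)) z / 2 & D2 ein z (ein' z) b.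
Proof. exact: pser_D2 exp_type_ein. Qed.

Lemma ein0 : ein 0 = 0.
Proof. exact: pser0 exp_type_ein. Qed.

(** Differentiation cancels the factor k in the denominator k k! of the coefficients, so that z
    Ein'(z) has the coefficients of 1 - e^(-z). This equation is the source of all estimates on
    Ein. *)
Lemma ein'E z : z * ein' z = 1 - cexp (- z).
Proof.
have L1 := climZ z (psum_cvg z (exp_type_dcoef exp_type_ein)).
apply: (clim_unique L1) => e e0.
have [N NH] := clim_shift (psum_cvg (- z) (@exp_type_exp R)) e0.
exists N => n /NH; rewrite -cabsN; congr (cabs _ < e).
rewrite opprB -[pser _ _]/(cexp (- z)).
suff -> : z * psum (dcoef ein_c) z n = 1 - psum (@exp_c R) (- z) n.+1 by ring.
elim: n => [|n IH].
  rewrite /psum big_ord_recr !big_ord0 /= /exp_c fact0 expr0; by field.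
rewrite (psumS _ _ n) (psumS _ _ n.+1) mulrDr IH /dcoef /ein_c /exp_c.
rewrite (exprNn z) !exprS.
have : ((n.+1)`!%:R : C) != 0 by rewrite pnatr_eq0 -lt0n fact_gt0.
have : (n.+1%:R : C) != 0 by rewrite pnatr_eq0.
move: (n.+1%:R : C) ((n.+1)`!%:R : C) (psum _ _ _) ((-1) ^+ n : C) (z ^+ n) => m k p y x m0 k0.
by field; rewrite m0 k0.
Qed.

Lemma cj_ein z : ein (cj z) = cj (ein z).
Proof.
apply: pser_cj exp_type_ein _ => -[|k].
  by apply: complex_ext; rewrite !reimE ?oppr0.
rewrite /ein_c -natrM cjM cj_rat; congr (_ * _).
elim: k => [|k IH]; first by rewrite !expr0; apply: complex_ext; rewrite !reimE ?oppr0.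
rewrite !exprS cjM IH; congr (_ * _).
by apply: complex_ext; rewrite !reimE ?oppr0.
Qed.

Lemma im_ein_rc x : im (ein (rc x)) = 0.
Proof.
have /(congr1 (@im R)) : ein (rc x) = cj (ein (rc x)).
  by rewrite -cj_ein; congr ein; apply: complex_ext; rewrite !reimE ?oppr0.
rewrite /cj !reimE => H; lra.
Qed.

End EntireLog.

(** * The map *)

Section EssentialSingularity.
Variable R : realType.
Local Notation C := (CC R).

Lemma rcV (x : R) : (rc x)^-1 = rc x^-1 :> C.
Proof.
have [->|x0] := eqVneq x 0; first by rewrite rc0 !invr0.
have X0 : rc x != 0 by rewrite -cabs_eq0 cabs_rc normr_eq0.
by apply: (mulfI X0); rewrite -rcM !divff.
Qed.

(** Growth along the positive half-axis excludes a removable singularity; boundedness along the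
    negative one excludes a pole. *)
Lemma essential_singularity_real_axis (F : C -> C) (k M : R) : 0 < k ->
  (forall x : R, 0 < x -> k / x <= cabs (F (rc x))) ->
  (forall x : R, 0 < x -> cabs (F (- rc x)) <= M) ->
  essential_singularity_at0 F.
Proof.
move=> k0 Fp Fn; split.
  move=> [G [Gd /nbhsCP[d d0 dE]]].
  have /derivable1_diffP/differentiable_continuous Gc := nbhs_singleton Gd.
  have {}Gc : cont G 0 by apply/contP.
  have [d' d'0 d'H] := Gc 1 ltr01.
  have B0 : 0 < cabs (G 0) + 1 by rewrite ltr_wpDl// cabs_ge0.
  pose x := Num.min (d / 2) (Num.min (d' / 2) (k / (cabs (G 0) + 1) / 2)).
  have x0 : 0 < x by rewrite !lt_min !divr_gt0.
  have xd : x < d by rewrite /x gt_min; apply/orP; left; lra.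
  have xd' : x < d' by rewrite /x !gt_min; apply/orP; right; apply/orP; left; lra.
  have xk : x * (cabs (G 0) + 1) < k.
    rewrite -ltr_pdivlMr//; have : 0 < k / (cabs (G 0) + 1) by rewrite divr_gt0.
    by rewrite /x !gt_min => ?; apply/orP; right; apply/orP; right; lra.
  have cx : cabs (rc x) = x by rewrite cabs_rc gtr0_norm.
  have := dE (rc x); rewrite subr0 cx => /(_ xd).
  have rx0 : rc x != 0 by rewrite -cabs_gt0 cx.
  move=> /(_ rx0) E; have := Fp x x0; rewrite -E.
  have := d'H (rc x); rewrite subr0 cx => /(_ xd') H.
  rewrite ler_pdivrMr// => H'.
  have := cabs_triangle (G 0) (G (rc x)) 0; rewrite !subr0 => H''.
  have : cabs (G (rc x)) * x <= (cabs (G 0) + 1) * x.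
    by apply: ler_wpM2r; [exact: ltW|lra].
  nra.
move=> H.
have /H /nbhsCP[d d0 dH] : nbhs (None : sphere R) (Some @` (~` (cdisc 0 M)) `|` [set None]).
  by exists (cdisc 0 M) => //; split; [exact: compact_cdisc|exact: closed_cdisc].
have d2 : 0 < d / 2 by rewrite divr_gt0.
have c : cabs (- rc (d / 2)) = d / 2 by rewrite cabsN cabs_rc gtr0_norm.
have := dH (- rc (d / 2)); rewrite subr0 c => H1.
have {H1} [||[w wM [wE]]|//] := H1.
- by lra.
- by rewrite -cabs_gt0 c.
by apply: wM; rewrite wE /cdisc /= subr0; exact: Fn.
Qed.

(** This permits differentiating an identity between functions: expand both sides and compare first
    coefficients. *)
Lemma D2_unique (f : C -> C) p a a' b b' : D2 f p a b -> D2 f p a' b' -> a = a'.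
Proof.
move=> [bc fE] [b'c fE'].
apply/eqP; rewrite -subr_eq0 -cabs_eq0; apply/negPn/negP => n0.
have N0 : 0 < cabs (a - a') by rewrite lt_def n0 cabs_ge0.
have H : cont (fun h => h * (b' h - b h)) 0.
  have D : cont (fun h => b' h + -1 * b h) 0.
    by apply: contD => //; apply: contM => //; exact: cont_cst.
  have : cont (fun h => h * (b' h + -1 * b h)) 0 by apply: contM => //; exact: cont_id.
  move=> K e /K[d d0 dH]; exists d => // w /dH; congr (cabs _ < e); ring.
have [d d0 dH] := H _ N0.
pose h : C := rc (d / 2).
have hd : cabs h = d / 2 by rewrite cabs_rc gtr0_norm// divr_gt0.
have h0 : h != 0 by rewrite -cabs_gt0 hd divr_gt0.
have := dH h; rewrite subr0 hd => /(_ ltac:(lra)).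
have -> : h * (b' h - b h) = a - a'.
  apply: (mulfI h0); have := fE h; rewrite fE' => E.
  have {}E : a' * h + h * h * b' h = a * h + h * h * b h.
    by apply: (addrI (f p)); rewrite !addrA.
  apply/eqP; rewrite -subr_eq0; apply/eqP.
  transitivity (a' * h + h * h * b' h - (a * h + h * h * b h)); first by ring.
  by rewrite E subrr.
by rewrite mul0r subr0 ltxx.
Qed.

End EssentialSingularity.

Section TheMap.
Variable R : realType.
Local Notation C := (CC R).
Local Notation cexp := (@cexp R).
Local Notation ein := (@ein R).
Local Notation ein' := (@ein' R).

Definition ein'' : C -> C := pser (dcoef (dcoef (@ein_c R))).

(** Both sides are the derivative of z Ein'(z) = 1 - e^(-z). *)
Lemma ein''E z : ein' z + z * ein'' z = cexp (- z).
Proof.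
have [b _ bD] := pser_D2 z (exp_type_dcoef (@exp_type_ein R)).
have D1 := D2_mul (D2_id z) bD.
have [b' _ b'D] := cexp_D2 (- z).
have DN : D2 (fun z : C => - z) z (-1) (fun=> 0).
  by split=> [|h]; [exact: cont_cst|ring].
have D3 := D2_add (D2_cst 1 z) (D2_mul (D2_cst (-1) z) (D2_comp DN b'D)).
have E : (fun z => 1 + -1 * cexp (- z)) = (fun z : C => id z * pser (dcoef (@ein_c R)) z).
  by apply/funext => w; rewrite mulN1r -ein'E.
rewrite E in D3.
have := D2_unique D1 D3; rewrite /= -/(ein'' _) -/(ein' _).
rewrite !mul1r add0r mul0r add0r => ->.
by rewrite !mulN1r mulrN1 opprK.
Qed.

(* (1 + x) e^(-Ein x) has derivative ((1 + x) e^(-x) - 1) e^(-Ein x) / x <= 0. *)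
Lemma exp_ein_ge (x : R) : 0 < x -> 1 + x <= expR (re (ein (rc x))).
Proof.
move=> x0.
pose K z := (1 + z) * cexp (- ein z).
have KD z : exists b, D2 K z (cexp (- ein z) * (1 - (1 + z) * ein' z)) b.
  have [b _ bD] := ein_D2 z.
  have [b' _ b'D] := cexp_D2 (- ein z).
  have DN w : D2 (fun z : C => - z) w (-1) (fun=> 0).
    by split=> [|h]; [exact: cont_cst|ring].
  have D := D2_mul (D2_add (D2_cst 1 z) (D2_id z)) (D2_comp (D2_comp bD (DN _)) b'D).
  have E : (0 + 1) * cexp (- ein z) + (1 + z) * (cexp (- ein z) * (-1 * ein' z)) =
      cexp (- ein z) * (1 - (1 + z) * ein' z).
    by move: (cexp _) (ein' z) => u v; ring.
  exact (ex_intro _ _ (D2_eq D E)).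
pose g t := re (1 * K (0 + rc t * rc x)).
pose g' t := re (1 * (cexp (- ein (0 + rc t * rc x)) *
  (1 - (1 + (0 + rc t * rc x)) * ein' (0 + rc t * rc x)) * rc x)).
have gD (t : R) : is_derive t 1 g (g' t).
  by have [b bD] := KD (0 + rc t * rc x); exact: D2_is_derive bD.
have gc : {within `[0, 1], continuous g}.
  by apply: derivable_within_continuous => t _; have [] := gD t.
have [t] := @MVT R g g' 0 1 ltr01 (fun t _ => gD t) gc.
rewrite in_itv /= => /andP[t0 t1]; rewrite subr0 mulr1 => E.
have g1 : g 1 = (1 + x) * expR (- re (ein (rc x))).
  rewrite /g rc1 mul1r add0r mul1r /K.
  have -> : - ein (rc x) = rc (- re (ein (rc x))).
    by apply: complex_ext; rewrite !reimE ?im_ein_rc ?oppr0.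
  by rewrite cexp_rc -rc1 -rcD -rcM.
have g0 : g 0 = 1.
  by rewrite /g rc0 mul0r add0r mul1r /K ein0 oppr0 cexp0 addr0 mulr1.
have g'0 : g' t <= 0.
  have tx : 0 < t * x by rewrite mulr_gt0.
  rewrite /g' add0r -rcM mul1r.
  have -> : - ein (rc (t * x)) = rc (- re (ein (rc (t * x)))).
    by apply: complex_ext; rewrite !reimE ?im_ein_rc ?oppr0.
  rewrite cexp_rc.
  have TX : rc (t * x) != 0 by rewrite -cabs_gt0 cabs_rc normr_gt0 gt_eqF.
  have -> : ein' (rc (t * x)) = rc ((1 - expR (- (t * x))) / (t * x)).
    apply: (mulfI TX); rewrite ein'E -rcN cexp_rc -rc1 -rcN -rcD -rcM; congr rc.
    by rewrite [RHS]mulrC divfK// gt_eqF.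
  rewrite -rc1 -rcD -rcM -rcN -rcD -!rcM re_rc.
  rewrite pmulr_lle0// pmulr_rle0 ?expR_gt0//.
  have := expR_ge1Dx (t * x).
  have := expRxMexpNx_1 (t * x); have := expR_gt0 (- (t * x)).
  move: (expR (t * x)) (expR (- (t * x))) (t * x) tx => a b s s0 b0 ab sa.
  rewrite subr_le0 mulrA ler_pdivlMr// mul1r; nra.
move: E; rewrite g1 g0 => E.
have : (1 + x) * expR (- re (ein (rc x))) <= 1 by lra.
by rewrite expRN ler_pdivrMr ?expR_gt0// mul1r.
Qed.

(** At -s with s > 0 the derivative of Ein is (e^s - 1) / s > 0, so Ein increases along the negative
    axis to Ein(0) = 0. *)
Lemma re_ein_neg (x : R) : 0 < x -> re (ein (- rc x)) <= 0.
Proof.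
move=> x0.
pose g t := re (1 * ein (0 + rc t * - rc x)).
pose g' t := re (1 * (ein' (0 + rc t * - rc x) * - rc x)).
have gD (t : R) : is_derive t 1 g (g' t).
  by have [b _ bD] := ein_D2 (0 + rc t * - rc x); exact: D2_is_derive bD.
have gc : {within `[0, 1], continuous g}.
  by apply: derivable_within_continuous => t _; have [] := gD t.
have [t] := @MVT R g g' 0 1 ltr01 (fun t _ => gD t) gc.
rewrite in_itv /= => /andP[t0 t1]; rewrite subr0 mulr1 => E.
have tx : 0 < t * x by rewrite mulr_gt0.
have : g' t <= 0.
  rewrite /g' add0r mul1r -rcN -rcM.
  have TX : rc (t * - x) != 0.
    by rewrite -cabs_gt0 cabs_rc mulrN normrN normr_gt0 gt_eqF.
  have -> : ein' (rc (t * - x)) = rc ((1 - expR (t * x)) / (t * - x)).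
    apply: (mulfI TX); rewrite ein'E -rcN mulrN opprK cexp_rc -rc1 -rcN -rcD -rcM.
    by congr rc; field; rewrite !gt_eqF.
  rewrite -rcM re_rc.
  have -> : (1 - expR (t * x)) / (t * - x) * - x = - ((expR (t * x) - 1) / t).
    by move: (expR _) => a; field; rewrite !gt_eqF.
  rewrite oppr_le0 divr_ge0 ?(ltW t0)// subr_ge0.
  by apply: le_trans (expR_ge1Dx _); rewrite lerDl ltW.
have -> : re (ein (- rc x)) = g 1 by rewrite /g rc1 !mul1r add0r.
have : g 0 = 0 by rewrite /g rc0 mul0r add0r mul1r ein0.
lra.
Qed.

(* At a degenerate critical point p one finds p^2 - e p + e = 0 and
   e^(-p) - 1 + p = e (p - 2) / p, which is too large for small p. *)
Lemma critical_points_simple : exists2 e0 : R, 0 < e0 & forall (eps : R) (p : C),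
  0 < eps <= e0 -> p != 0 -> ein' p - rc eps * p^-1 ^+ 2 = 0 ->
  ein'' p / 2 + rc eps * p^-1 ^+ 3 != 0.
Proof.
have [b b0 [bc cE]] := cexp_D2 (0 : C).
have half0 : 0 < (1 / 2 : R) by rewrite divr_gt0.
have [d d0 dH] := bc _ half0.
(* From |p|^2 = eps |p - 1|, the bound 1/6 forces |p| <= 1/2, and d^2 / 2 then forces |p| < d.
   Within [d] the second-order coefficient of exp, which is 1/2 at 0, has modulus at most 1. *)
exists (Num.min (1 / 6) (d ^+ 2 / 2)).
  by rewrite lt_min !divr_gt0// exprn_gt0.
move=> eps p; rewrite le_min => /andP[e0 /andP[e6 ed]] p0 E1; apply/negP => /eqP E2.
have P0 : 0 < cabs p by rewrite cabs_gt0.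
have ce : cabs (rc eps) = eps by rewrite cabs_rc gtr0_norm.
have := ein''E p; have := ein'E p.
move: (ein' p) (ein'' p) (rc eps) ce E1 E2 => u v e ce E1 E2 H1 H2.
have E1' : u = e * p^-1 ^+ 2 by apply/eqP; rewrite -subr_eq0 E1.
have E2' : v = - 2 * e * p^-1 ^+ 3.
  have : v / 2 + e * p^-1 ^+ 3 - e * p^-1 ^+ 3 = - (e * p^-1 ^+ 3) by rewrite E2 sub0r.
  rewrite addrK => H; rewrite -[v](@divfK _ 2) ?pnatr_eq0// H; ring.
have X : cexp (- p) = - (e * p^-1 ^+ 2).
  by rewrite -H2 E1' E2'; field.
have Q : p ^+ 2 = e * (p - 1).
  move: H1; rewrite X E1' => H1.
  have : p * (e * p^-1 ^+ 2) * p ^+ 2 = (1 - - (e * p^-1 ^+ 2)) * p ^+ 2 by rewrite H1.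
  have -> : p * (e * p^-1 ^+ 2) * p ^+ 2 = e * p by field.
  have -> : (1 - - (e * p^-1 ^+ 2)) * p ^+ 2 = p ^+ 2 + e by field.
  by move=> H; rewrite mulrBr mulr1 H addrK.
have Qa : cabs p ^+ 2 = eps * cabs (p - 1) by rewrite -cabsX Q cabsM ce.
have p1 : cabs (p - 1) <= cabs p + 1 by have := cabsB p 1; rewrite cabs1.
have ph : cabs p <= 1 / 2.
  rewrite leNgt; apply/negP => ph; move: Qa ph p1 e6 e0 P0; rewrite expr2.
  move: (cabs (p - 1)) (cabs p) => s t; clear => *; nra.
have pd : cabs p < d.
  rewrite -(@ltr_pXn2r _ 2) ?nnegrE ?cabs_ge0 ?ltW// Qa.
  have : cabs (p - 1) <= 3 / 2 by lra.
  move: (d ^+ 2) (cabs (p - 1)) ed (exprn_gt0 2 d0) e0 => D t; clear => *; nra.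
have B : cabs (b (- p)) <= 1.
  have := dH (- p); rewrite subr0 cabsN => /(_ pd).
  have := cabs_triangle (b 0) (b (- p)) 0; rewrite !subr0 [in cabs (b 0)]b0 cexp0.
  by rewrite cabsM cabs1 cabsV cabs_nat; lra.
have := cE (- p); rewrite add0r cexp0 X mul1r mulrNN => H.
have {}H : e * (p - 2) = p * p * p * b (- p).
  have : - (e * p^-1 ^+ 2) * p ^+ 2 = (1 - p + p * p * b (- p)) * p ^+ 2 by rewrite H.
  have -> : - (e * p^-1 ^+ 2) * p ^+ 2 = - e by field.
  move: (b (- p)) => w H'.
  have : e = - ((1 - p + p * p * w) * p ^+ 2) by rewrite -H' opprK.
  move=> H''.
  have Q' : e * p = p ^+ 2 + e by rewrite Q; ring.
  have E3 : e * (p - 2) = p ^+ 2 - e by rewrite Q; ring.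
  apply: (mulfI p0); rewrite E3 mulrBr [p * e]mulrC Q'.
  rewrite [in LHS]H''; ring.
have : cabs (e * (p - 2)) <= cabs p ^+ 3.
  rewrite H cabsM (_ : p * p * p = p ^+ 3); last by ring.
  by rewrite cabsX ler_piMr// exprn_ge0// cabs_ge0.
(* Dividing by eps leaves |p - 2| <= |p - 1| |p|, impossible for |p| <= 1/2: the left side is at
   least 3/2, the right side at most 3/4. *)
rewrite cabsM ce exprSr Qa -mulrA ler_pM2l//.
have := cabs_triangle p 2 0; rewrite !subr0 cabs_nat (cabsC 2).
have := cabs_ge0 (p - 1); move: P0 ph p1.
move: (cabs (p - 2)) (cabs (p - 1)) (cabs p) => s t r; clear => *; nra.
Qed.

Lemma cexp_near1 : exists2 d : R, 0 < d & forall w, cabs w < d ->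
  32 + `|im (rc 64 * cexp w)| < re (rc 64 * cexp w).
Proof.
have [b _ bD] := cexp_D2 (0 : C).
have cc : cont cexp 0 by apply: smooth2_cont; exists (cexp 0), b.
(* An error of 1/5 in the exponential keeps the real part above 64 * 4/5 and the imaginary part
   below 64/5, and 32 + 64/5 < 64 * 4/5. *)
have h0 : 0 < (1 / 5 : R) by rewrite divr_gt0.
have [d d0 dH] := cc _ h0; exists d => // w wd.
have := dH w; rewrite subr0 cexp0 => /(_ wd) H.
have := cabs_ge_im (cexp w - 1); rewrite imD imN im1 oppr0 addr0 => H1.
have := cabs_ge_re (cexp w - 1); rewrite reD reN re1 ler_norml => /andP[H2 _].
rewrite reM imM re_rc im_rc !mul0r addr0 subr0 normrM (ger0_norm (ler0n _ _)).
lra.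
Qed.

Variable eps : R.
Hypothesis eps0 : 0 < eps.
Hypothesis eps1 : eps <= 1.

Definition baker_log (z : C) : C := ein z + rc eps * z^-1.
Definition baker_log' (z : C) : C := ein' z - rc eps * z^-1 ^+ 2.
(** With the default value of the inverse, the map takes the value 64 at 0, so it vanishes nowhere
    on the whole of C. *)
Definition baker_map (z : C) : C := rc 64 * cexp (baker_log z).

Lemma baker_map_neq0 z : baker_map z != 0.
Proof.
rewrite mulf_neq0 ?cexp_neq0//.
by rewrite -cabs_eq0 cabs_rc normr_eq0 pnatr_eq0.
Qed.

Lemma baker_log_D2 p : p != 0 ->
  exists2 b, b 0 = ein'' p / 2 + rc eps * p^-1 ^+ 3 & D2 baker_log p (baker_log' p) b.
Proof.
move=> p0; have [b bE bD] := ein_D2 p; have [b' b'E b'D] := D2_inv p0.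
have D := D2_add bD (D2_mul (D2_cst (rc eps) p) b'D).
have E : ein' p + (0 * p^-1 + rc eps * (- p^-1 ^+ 2)) = baker_log' p.
  by rewrite /baker_log'; move: (ein' p) => u; ring.
refine (ex_intro2 _ _ _ _ (D2_eq D E)).
by rewrite /= bE b'E -/(ein'' p); move: (ein'' p) => u; ring.
Qed.

(** The second coefficient is recorded only at critical points: elsewhere the first one is nonzero
    and already gives openness. *)
Lemma baker_map_D2 p : p != 0 ->
  exists2 b, (baker_log' p = 0 -> b 0 = baker_map p * (ein'' p / 2 + rc eps * p^-1 ^+ 3)) &
    D2 baker_map p (baker_map p * baker_log' p) b.
Proof.
move=> p0; have [b bE bD] := baker_log_D2 p0; have [b' b'E b'D] := cexp_D2 (baker_log p).
have D := D2_mul (D2_cst (rc 64) p) (D2_comp bD b'D).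
have E : 0 * cexp (baker_log p) + rc 64 * (cexp (baker_log p) * baker_log' p) =
    baker_map p * baker_log' p.
  by rewrite /baker_map; move: (cexp _) (baker_log' p) (rc 64) => u v w; ring.
refine (ex_intro2 _ _ _ _ (D2_eq D E)).
move=> E0; cbv beta; rewrite E0 !(mul0r, add0r, addr0) bE /baker_map.
by rewrite mulrA.
Qed.

Lemma baker_log_smooth2 p : p != 0 -> smooth2 baker_log p.
Proof. by move=> /baker_log_D2[b _ bD]; exists (baker_log' p), b. Qed.

Lemma baker_map_smooth2 p : p != 0 -> smooth2 baker_map p.
Proof. by move=> /baker_map_D2[b _ bD]; exists (baker_map p * baker_log' p), b. Qed.

Lemma baker_map_rc x : baker_map (rc x) = rc (64 * expR (re (ein (rc x)) + eps / x)).
Proof.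
rewrite /baker_map /baker_log rcM -cexp_rc rcV -rcM rcD; congr (_ * cexp (_ + _)).
by apply: complex_ext; rewrite !reimE// im_ein_rc.
Qed.

Lemma baker_map_rc_ge x : 0 < x -> 64 * (1 + x) * expR (eps / x) <= re (baker_map (rc x)).
Proof.
move=> x0; rewrite baker_map_rc re_rc expRD mulrA.
apply: ler_wpM2r; first exact: expR_ge0.
by apply: ler_wpM2l => //; exact: exp_ein_ge.
Qed.

Lemma baker_map_rc_ge1 x : 0 < x -> 64 * (1 + x) <= re (baker_map (rc x)).
Proof.
move=> x0; apply: le_trans (baker_map_rc_ge x0).
rewrite ler_peMr//; first lra.
apply: le_trans (expR_ge1Dx _); rewrite lerDl divr_ge0//; exact: ltW.
Qed.

Lemma cabs_baker_map_neg x : 0 < x -> cabs (baker_map (- rc x)) <= 64.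
Proof.
move=> x0; rewrite /baker_map cabsM cabs_rc ger0_norm// cabs_cexp.
rewrite ger_pMr// expR_le1 /baker_log -rcN rcV -rcM reD re_rc rcN.
have := re_ein_neg x0; have : eps * (- x)^-1 <= 0.
  by rewrite invrN mulrN oppr_le0 divr_ge0// ltW.
lra.
Qed.

Lemma baker_map_transcendental : transcendental_self_map baker_map.
Proof.
split.
- by move=> z _; exact: baker_map_neq0.
- by move=> z /baker_map_D2[b _ bD]; exact: D2_derivable bD.
- apply: (@essential_singularity_real_axis _ _ eps 64) => // [x x0|];
    last exact: cabs_baker_map_neg.
  apply: le_trans (cabs_ge_re _); apply: le_trans (ler_norm _).
  apply: le_trans (baker_map_rc_ge x0).
  have := expR_ge1Dx (eps / x); have : 0 < eps / x by rewrite divr_gt0.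
  move: (eps / x) (expR _) => a e a0 ae; nra.
- apply: (@essential_singularity_real_axis _ _ 1 64) => // x x0.
    apply: le_trans (cabs_ge_re _); apply: le_trans (ler_norm _).
    rewrite rcV; apply: le_trans (baker_map_rc_ge1 _); last by rewrite invr_gt0.
    have : 0 < x^-1 by rewrite invr_gt0.
    by rewrite div1r; lra.
  by rewrite -rcN rcV invrN rcN; apply: cabs_baker_map_neg; rewrite invr_gt0.
Qed.

(** On this set the map differs from multiplication by a real slope H >= 64 by at most 8H. The
    vertex 32 absorbs this error, which is counted once in the real and once in the imaginary
    part. *)
Definition cone : set C := [set z | 32 + `|im z| < re z].

Lemma open_cone : open cone.
Proof.
rewrite openE => z; rewrite /cone /= => zc.
have d0 : 0 < (re z - `|im z| - 32) / 2 by lra.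
apply/nbhsCP; exists ((re z - `|im z| - 32) / 2) => // w wz.
have := cabs_ge_re (w - z); have := cabs_ge_im (w - z).
rewrite !reimE => H1; rewrite ler_norml => /andP[H2 _]; rewrite /=.
have := ler_normD (im w - im z) (im z); rewrite subrK /=; lra.
Qed.

Lemma baker_map_rc_cone x : 0 < x -> cone (baker_map (rc x)).
Proof.
move=> x0; have := baker_map_rc_ge1 x0; rewrite /cone /= baker_map_rc im_rc normr0 addr0.
lra.
Qed.

(* baker_map z / z has logarithmic derivative -(e^(-z) + eps / z) / z, so it barely
   changes along the vertical segment from the real axis to a point of the cone. *)
Lemma baker_map_vertical (x y : R) : 32 + `|y| < x ->
  forall z, z = rc x + ii R * rc y ->
  cabs (baker_map z / z - baker_map (rc x) / rc x) <= 4 / x * cabs (baker_map (rc x) / rc x).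
Proof.
move=> xy z zE.
have y0 := normr_ge0 y.
have x0 : 0 < x by lra.
pose w : C := ii R * rc y.
have cw : cabs w = `|y| by rewrite cabsM cabs_ii mul1r cabs_rc.
have rew t : re (rc x + rc t * w) = x by rewrite /w !reimE; ring.
have cz t : x <= cabs (rc x + rc t * w).
  by have := cabs_ge_re (rc x + rc t * w); rewrite rew ger0_norm// ltW.
have nz t : rc x + rc t * w != 0 by rewrite -cabs_gt0; apply: lt_le_trans (cz t).
pose h p : C := baker_map p * p^-1.
pose h' p : C := h p * (- (cexp (- p) + rc eps * p^-1) * p^-1).
have hD p : p != 0 -> exists b, D2 h p (h' p) b.
  move=> p0; have [b _ bD] := baker_map_D2 p0; have [b' _ b'D] := D2_inv p0.
  have D := D2_mul bD b'D.
  have E : baker_map p * baker_log' p * p^-1 + baker_map p * (- p^-1 ^+ 2) = h' p.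
    have -> : baker_log' p = (1 - cexp (- p)) / p - rc eps * p^-1 ^+ 2.
      by rewrite /baker_log' -ein'E [p * _]mulrC mulfK.
    rewrite /h' /h; move: (baker_map p) (cexp (- p)) (rc eps) => a u e.
    by field.
  exact (ex_intro _ _ (D2_eq D E)).
have k1 p : x <= cabs p -> re p = x ->
    cabs (- (cexp (- p) + rc eps * p^-1) * p^-1 * w) <= 2 / x.
  move=> xp rp; rewrite [cabs (_ * w)]cabsM cw cabsM cabsN cabsV.
  have p0 : 0 < cabs p by apply: lt_le_trans xp.
  have E : cabs (cexp (- p) + rc eps * p^-1) <= 2 / x.
    apply: le_trans (cabsD _ _) _; rewrite cabs_cexp reN rp cabsM cabs_rc cabsV.
    rewrite (gtr0_norm eps0) expRN.
    have -> : 2 / x = x^-1 + 1 * x^-1 by ring.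
    apply: lerD.
      rewrite lef_pV2 ?posrE ?expR_gt0//.
      by apply: le_trans (expR_ge1Dx _); rewrite lerDr.
    by apply: ler_pM; rewrite ?invr_ge0 ?cabs_ge0 ?(ltW eps0)// lef_pV2 ?posrE.
  rewrite -mulrA; apply: le_trans (_ : 2 / x * 1 <= _); last by rewrite mulr1.
  apply: ler_pM E _; rewrite ?cabs_ge0 ?mulr_ge0 ?invr_ge0 ?cabs_ge0//.
  by rewrite mulrC ler_pdivrMr// mul1r; lra.
(* The derivative of [h] is bounded in terms of |h| itself, so the maximum of |h| on the segment is
   bounded first: it is at most |h(x)| plus 2 / x <= 1 / 16 times itself, hence at most 2 |h(x)|. *)
pose phi (t : R) := cabs (h (rc x + rc t * w)).
have phic : {within `[0, 1], continuous phi}.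
  apply: continuous_subspaceT => t.
  have [b bD] := hD _ (nz t).
  have hc : cont h (rc x + rc t * w) by apply: smooth2_cont; exists (h' (rc x + rc t * w)), b.
  move=> V /nbhs_RP[e e1 eV].
  have [d d0 dH] := cont_cabs hc e1.
  apply/nbhs_RP; exists (d / (`|y| + 1)); first by rewrite divr_gt0// ltr_wpDl.
  move=> s; rewrite ltr_pdivlMr ?ltr_wpDl// => st; apply: eV.
  have := dH (rc x + rc s * w).
  rewrite -rcN -rcD cabs_rc; apply.
  have -> : rc x + rc s * w - (rc x + rc t * w) = rc (s - t) * w by rewrite rcD rcN; ring.
  rewrite cabsM cw cabs_rc; apply: le_lt_trans st; rewrite ler_wpM2l//; lra.
have [t0] := EVT_max ler01 phic.
rewrite in_itv /= => /andP[t00 t01] tmax.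
have mv (t : R) : 0 <= t <= 1 -> cabs (h (rc x + rc t * w) - h (rc x)) <= phi t0 * (2 / x).
  move=> /andP[t0' t1'].
  apply: (@segment_mean_value _ h h') => s /andP[s0 s1].
    by apply: hD; rewrite mulrA -rcM; exact: nz.
  have -> : rc s * (rc t * w) = rc (s * t) * w by rewrite mulrA rcM.
  have st : s * t \in `[0, 1]%R by rewrite in_itv /= mulr_ge0// mulr_ile1.
  have := k1 _ (cz (s * t)) (rew (s * t)); have := tmax _ st; rewrite /phi.
  move: (rc x + rc (s * t) * w) => p H1 H2.
  have -> : h' p * (rc t * w) =
      h p * (rc t * (- (cexp (- p) + rc eps * p^-1) * p^-1 * w)).
    by rewrite /h'; move: (h p) (_ / p) (rc t) => a b c; ring.
  rewrite cabsM; apply: ler_pM; rewrite ?cabs_ge0//.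
  by rewrite cabsM cabs_rc ger0_norm//; apply: le_trans H2; rewrite ler_piMl// cabs_ge0.
have x16 : 2 / x <= 1 / 16 by rewrite ler_pdivrMr//; lra.
have M2 : phi t0 <= 2 * cabs (h (rc x)).
  have := mv t0; rewrite t00 t01 => /(_ isT).
  have := cabs_triangle (h (rc x)) (h (rc x + rc t0 * w)) 0; rewrite !subr0 -/(phi t0).
  have : 0 <= phi t0 by exact: cabs_ge0.
  have : 0 <= 2 / x by rewrite divr_ge0// ltW.
  move: (2 / x) x16 (phi t0) => k *; nra.
have := mv 1; rewrite ler01 lexx => /(_ isT); rewrite rc1 mul1r -zE => H.
apply: le_trans H _.
have -> : 4 / x * cabs (h (rc x)) = 2 * cabs (h (rc x)) * (2 / x) by ring.
by rewrite ler_wpM2r// divr_ge0// ltW.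
Qed.

Lemma baker_map_cone z : cone z -> cone (baker_map z) /\ 2 * re z <= re (baker_map z).
Proof.
(* Here k + i y is the point with |y| = [f], [l] the slope H, [e] the modulus of the error; [a] and
   [d] are the sizes of the imaginary and real parts of the image. The real part exceeds |imaginary
   part| by at least (k - f - 16) l > 16 * 64. *)
have key (a b c d e f k l : R) : d = k * l + c -> a <= f * l + b -> b <= e ->
    - e <= c -> e <= 8 * l -> 64 <= l -> 32 + f < k -> 0 <= f ->
    32 + a < d /\ 2 * k <= d.
  by clear=> -> *; split; nra.
rewrite /cone /= => zc.
have i0 := normr_ge0 (im z).
set x := re z in zc *; set y := im z in zc i0 *.
have x0 : 0 < x by lra.
have zE : z = rc x + ii R * rc y by apply: complex_ext; rewrite !reimE /x /y; ring.
have := baker_map_vertical zc zE.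
have zx : x <= cabs z by apply: le_trans (cabs_ge_re z); exact: ler_norm.
have z0 : z != 0 by rewrite -cabs_gt0; exact: lt_le_trans zx.
have -> : baker_map (rc x) / rc x = rc (re (baker_map (rc x)) / x).
  rewrite rcM rcV; congr (_ * _).
  by apply: complex_ext; [rewrite re_rc|rewrite im_rc baker_map_rc im_rc].
set H := re (baker_map (rc x)) / x.
have H64 : 64 <= H.
  by rewrite /H ler_pdivlMr//; have := baker_map_rc_ge1 x0; lra.
rewrite cabs_rc (ger0_norm (le_trans _ H64))//.
set u := baker_map z / z - rc H => uH.
have fE : baker_map z = z * rc H + z * u.
  by rewrite -mulrDr addrC subrK mulrC divfK.
have zu : cabs (z * u) <= 8 * H.
  rewrite cabsM; apply: (@le_trans _ _ ((2 * x) * (4 / x * H))); last first.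
    by rewrite le_eqVlt; apply/orP; left; apply/eqP; field; rewrite gt_eqF.
  apply: ler_pM; rewrite ?cabs_ge0//.
  have := cabs_le_reim z; rewrite -/x -/y (gtr0_norm x0); lra.
have r1 : re (baker_map z) = x * H + re (z * u)
  by rewrite fE reD; congr (_ + _); rewrite !reimE /x; ring.
have i1 : im (baker_map z) = y * H + im (z * u)
  by rewrite fE imD; congr (_ + _); rewrite !reimE /y; ring.
have := ler_normD (y * H) (im (z * u)); rewrite -i1 normrM (ger0_norm (le_trans _ H64))// => H1.
have H2 := cabs_ge_im (z * u).
have := cabs_ge_re (z * u); rewrite ler_norml => /andP[H3 _].
exact: key r1 H1 H2 H3 zu H64 zc i0.
Qed.

Lemma iter_baker_map_cone n z : cone z ->
  cone (iter n baker_map z) /\ 2 ^+ n <= re (iter n baker_map z).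
Proof.
move=> zc; elim: n => [|n [IHc IHr]].
  split=> //; rewrite expr0 /=; move: zc; rewrite /cone /=.
  by have := normr_ge0 (im z); lra.
have [H1 H2] := baker_map_cone IHc; split=> //=.
by rewrite exprS; apply: le_trans H2; lra.
Qed.

End TheMap.

(** * Topology of the plane and of the sphere *)

Section QuasiComponents.
Variable R : realType.
Variable T : topologicalType.
Hypothesis hT : hausdorff_space T.
Hypothesis cT : compact [set: T].

Definition rel_clopen (X D : set T) : Prop :=
  [/\ D `<=` X, closed D & closed (X `\` D)].

Lemma rel_clopenI (X D E : set T) :
  rel_clopen X D -> rel_clopen X E -> rel_clopen X (D `&` E).
Proof.
move=> [DX cD cXD] [EX cE cXE]; split; first by move=> z [/DX].
- exact: closedI.
- by rewrite setDIr; exact: closedU.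
Qed.

(** In a compact Hausdorff space, quasi-components of closed sets are connected. A splitting of the
    quasi-component is separated by disjoint open sets, compactness spreads the splitting to some
    relatively clopen [D], and the half of [D] containing [x] then contains the whole
    quasi-component. *)
Lemma quasi_component_sub (X : set T) (x : T) : closed X -> X x ->
  \bigcap_(D in [set D | rel_clopen X D /\ D x]) D `<=` connected_component X x.
Proof.
move=> cX Xx.
set QQ := [set D | _]; pose Q := \bigcap_(D in QQ) D.
have QQX : QQ X by split=> //; split=> //; rewrite setDv; exact: closed0.
have Qx : Q x by move=> D [].
have cQ : closed Q by apply: closed_bigI => D [[]].
apply: connected_component_max => //; first by move=> z /(_ X QQX).
move=> B [b Bb] [Oo opO BO] [F cF BF].
have cB : closed B by rewrite BF; exact: closedI.
have cB' : closed (Q `\` B).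
  rewrite (_ : Q `\` B = Q `&` ~` Oo); first by apply: closedI => //; exact: open_closedC.
  apply/seteqP; split=> z [Qz]; first by move=> nB; split=> // Ooz; apply: nB; rewrite BO.
  by move=> nO; split=> //; rewrite BO => -[].
have BQ : B `<=` Q by rewrite BO => z [].
have dis : B `&` (Q `\` B) = set0 by apply/seteqP; split=> z // [? []].
have [U [V [oU oV BU BV UV]]] := (@normal_openP R T).1 (compact_normal hT cT) _ _ cB cB' dis.
(* Otherwise the sets D outside U and V generate a proper filter, whose cluster point lies in the
   quasi-component but in neither open set. *)
have [D QD DUV] : exists2 D, QQ D & D `<=` U `|` V.
  apply: contrapT => nD.
  pose Z := ~` (U `|` V).
  have cZ : closed Z by apply: open_closedC; exact: openU.
  pose G := filter_from QQ (fun D => D `&` Z).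
  have FG : Filter G.
    apply: filter_from_filter; first by exists X.
    move=> D E [rD Dx] [rE Ex]; exists (D `&` E).
      by split; [exact: rel_clopenI|split].
    by move=> z [[]].
  have PG : ProperFilter G.
    apply: filter_from_proper => D QD; apply: contrapT => D0; apply: nD.
    exists D => // z Dz; apply: contrapT => nz; apply: D0; by exists z.
  have [p [_ pG]] := cT PG filterT.
  have pD D : QQ D -> (D `&` Z) p.
    move=> QD; have cDZ : closed (D `&` Z) by apply: closedI => //; case: QD => -[].
    apply: cDZ => W Wp; have GD : G (D `&` Z) by exists D.
    by have [q [q1 q2]] := pG _ _ GD Wp; exists q.
  have Qp : Q p by move=> D /pD[].
  have [_ nUV] := pD X QQX; apply: nUV.
  have [Bp|nBp] := pselect (B p); first by left; exact: BU.
  by right; apply: BV.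
have [[DX cD cXD] Dx] := QD.
have cDU : closed (D `&` U).
  rewrite (_ : D `&` U = D `&` ~` V); first by apply: closedI => //; exact: open_closedC.
  apply/seteqP; split=> z [Dz].
    move=> Uz; split=> // Vz.
    by have : (U `&` V) z by []; rewrite UV.
  by move=> nV; split=> //; case: (DUV z Dz).
have cDV : closed (D `&` V).
  rewrite (_ : D `&` V = D `&` ~` U); first by apply: closedI => //; exact: open_closedC.
  apply/seteqP; split=> z [Dz].
    move=> Vz; split=> // Uz.
    by have : (U `&` V) z by []; rewrite UV.
  by move=> nU; split=> //; case: (DUV z Dz).
have QDU : Q `<=` D by move=> z /(_ D QD).
have rU : rel_clopen X (D `&` U).
  split=> //; first by move=> z [/DX].
  rewrite (_ : X `\` (D `&` U) = (X `\` D) `|` (D `&` V)); first exact: closedU.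
  apply/seteqP; split=> z.
    move=> [Xz nDU]; have [Dz|nDz] := pselect (D z); last by left.
    by right; split=> //; have [Uz|//] := DUV z Dz; case: nDU.
  case=> [[Xz nDz]|[Dz Vz]]; split=> //; [by move=> []|exact: DX|move=> [_ Uz]].
  by have : (U `&` V) z by []; rewrite UV.
have rV : rel_clopen X (D `&` V).
  split=> //; first by move=> z [/DX].
  rewrite (_ : X `\` (D `&` V) = (X `\` D) `|` (D `&` U)); first exact: closedU.
  apply/seteqP; split=> z.
    move=> [Xz nDV]; have [Dz|nDz] := pselect (D z); last by left.
    by right; split=> //; have [//|Vz] := DUV z Dz; case: nDV.
  case=> [[Xz nDz]|[Dz Uz]]; split=> //; [by move=> []|exact: DX|move=> [_ Vz]].
  by have : (U `&` V) z by []; rewrite UV.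
have [Bx|nBx] := pselect (B x); last first.
  have Qv : QQ (D `&` V) by split=> //; split=> //; apply: BV.
  have [_ Vb] := BQ b Bb _ Qv.
  exfalso; have : (U `&` V) b by split=> //; exact: BU.
  by rewrite UV.
apply/seteqP; split=> // z Qz; apply: contrapT => nBz.
have Qu : QQ (D `&` U) by split=> //; split=> //; apply: BU.
have [_ Uz] := Qz _ Qu.
have : (U `&` V) z by split=> //; exact: BV.
by rewrite UV.
Qed.

(** To be used with 0 and infinity for [a] and [b]: the clopen set obtained is a hole that is
    isolated from the rest of the complement, as a single component may fail to be. *)
Lemma separate_from_component (X : set T) (x a b : T) : closed X -> X x ->
  ~ connected_component X x a -> ~ connected_component X x b ->
  exists D, [/\ rel_clopen X D, D x, ~ D a & ~ D b].
Proof.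
move=> cX Xx.
have sep c : ~ connected_component X x c -> exists D, [/\ rel_clopen X D, D x & ~ D c].
  move=> nc; apply: contrapT => nD; apply: nc; apply: quasi_component_sub => //.
  by move=> D [rD Dx]; apply: contrapT => Dc; apply: nD; exists D.
move=> /sep[D [rD Dx Da]] /sep[E [rE Ex Eb]].
exists (D `&` E); split=> //; [exact: rel_clopenI|by move=> []..].
Qed.

End QuasiComponents.

Section PlaneTopology.
Variable R : realType.
Local Notation C := (CC R).
Local Notation Chat := (sphere R).

Lemma locally_compactC : locally_compact [set: C].
Proof.
move=> z _; rewrite withinET.
exists (cdisc z 1); last by split; [exact: compact_cdisc|exact: closed_cdisc].
by apply/nbhsCP; exists 1 => // w /ltW.
Qed.

Lemma hausdorffC : hausdorff_space C.
Proof. exact: norm_hausdorff. Qed.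

Lemma hausdorff_sphere : hausdorff_space Chat.
Proof.
by apply: one_point_compactification_hausdorff; [exact: locally_compactC|exact: hausdorffC].
Qed.

Lemma compact_sphere : compact [set: Chat].
Proof. exact: one_point_compactification_compact. Qed.

Lemma to_sphere_continuous : continuous (@to_sphere R).
Proof. exact: one_point_compactification_some_continuous. Qed.

Lemma open_to_sphere (U : set C) : open U -> open (@to_sphere R @` U).
Proof. exact: one_point_compactification_open_some. Qed.

Lemma to_sphere_inj : injective (@to_sphere R).
Proof. by move=> z w [->]. Qed.

Lemma segment_connectedC (z w : C) : connected [set z + rc t * (w - z) | t in `[0, 1]%classic].
Proof.
apply: connected_continuous_connected; first exact: segment_connected.
apply: continuous_subspaceT => t V /nbhsCP[e e0 eV].
have w1 : 0 < cabs (w - z) + 1 by rewrite ltr_wpDl// cabs_ge0.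
apply/nbhs_RP; exists (e / (cabs (w - z) + 1)); first by rewrite divr_gt0.
move=> s; rewrite ltr_pdivlMr// => st; apply: eV.
have -> : z + rc s * (w - z) - (z + rc t * (w - z)) = rc (s - t) * (w - z).
  by rewrite rcD rcN; ring.
rewrite cabsM cabs_rc; apply: le_lt_trans st; rewrite ler_wpM2l//; lra.
Qed.

Lemma disc_connected (z : C) (d : R) : connected (disc z d).
Proof.
have [d0|d0] := ltP 0 d; last first.
  rewrite (_ : disc z d = set0); first exact: connected0.
  apply/seteqP; split=> // w; rewrite /disc /= => wd.
  by have := cabs_ge0 (w - z); lra.
rewrite (_ : disc z d = \bigcup_(w in disc z d) [set z + rc t * (w - z) | t in `[0, 1]%classic]).
  apply: bigcup_connected; last by move=> w _; exact: segment_connectedC.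
  exists z => w _; exists 0; first by rewrite /= in_itv /= lexx ler01.
  by rewrite rc0 mul0r addr0.
apply/seteqP; split=> w.
  move=> wd; exists w => //; exists 1; first by rewrite /= in_itv /= lexx ler01.
  by rewrite rc1 mul1r addrC subrK.
move=> [u ud [t]]; rewrite /= in_itv /= => /andP[t0 t1] <-.
rewrite /disc /= addrC addKr cabsM cabs_rc ger0_norm//.
by apply: le_lt_trans ud; rewrite ler_piMl// cabs_ge0.
Qed.

Lemma open_component (A : set C) (z : C) : open A -> open (connected_component A z).
Proof.
move=> oA; rewrite openE => w Aw.
have /nbhsCP[d d0 dA] : nbhs w A.
  by apply: open_nbhs_nbhs; split=> //; exact: connected_component_sub Aw.
apply/nbhsCP; exists d => // u ud.
rewrite (same_connected_component Aw).
by exists (disc w d) => //; split; [exact: disc_center|exact: dA|exact: disc_connected].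
Qed.

(* A disc around a boundary point of [K] lies in [A] and meets the component, hence
   belongs to it; so [K] has no boundary points and is clopen. *)
Lemma compact_hole_empty (A K : set C) (z : C) : open A -> compact K ->
  K `<=` A -> open (connected_component A z `|` K) ->
  connected_component A z `&` K = set0 -> K = set0.
Proof.
move=> oA cK KA oU dis.
have [->//|/set0P[k Kk]] := eqVneq K set0.
have [oK|nK] := pselect (open K); last first.
  exfalso; apply: nK; rewrite openE => w Kw.
  have /nbhsCP[d d0 dU] : nbhs w (connected_component A z `|` K).
    by apply: open_nbhs_nbhs; split=> //; right.
  apply/nbhsCP; exists d => // u ud.
  have [Au|//] := dU u ud; exfalso.
  have : (connected_component A z `&` K) w; last by rewrite dis.
  split=> //; rewrite (same_connected_component Au).
  exists (disc w d); last exact: disc_center.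
  split=> //; last exact: disc_connected.
  by move=> v /dU[/connected_component_sub//|/KA].
have clK : closed K by apply: compact_closed cK; exact: hausdorffC.
have [M M0 KM] := compact_boundedC cK.
have E : disc k (2 * M + 2) `&` K = disc k (2 * M + 2).
  apply: (@disc_connected k (2 * M + 2)); [|by exists K|by exists K].
  by exists k; split=> //; apply: disc_center; lra.
move: E => /seteqP[_ /(_ (k + rc (2 * M + 1)))] H.
have : disc k (2 * M + 2) (k + rc (2 * M + 1)).
  by rewrite /disc /= addrC addKr cabs_rc ger0_norm; lra.
move=> /H[_ /KM].
have e : k + rc (2 * M + 1) - k = rc (2 * M + 1) by rewrite addrC addKr.
have := KM k Kk; have := cabsB (k + rc (2 * M + 1)) k.
rewrite e cabs_rc ger0_norm; last lra.
by clear -M0 => *; exfalso; lra.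
Qed.

(** Finitely many discs give [O] and their closed versions give [N]. The compact collar of [N]
    outside [O] will serve as boundary in the maximum principle. *)
Lemma compact_enlarge (K W : set C) : compact K -> open W -> K `<=` W ->
  exists O N : set C, [/\ open O, compact N, K `<=` O, O `<=` N & N `<=` W].
Proof.
move=> cK oW KW.
have cc : cover_compact K by rewrite -compact_cover.
have H z : K z -> exists d : R, 0 < d /\ cdisc z d `<=` W.
  move=> /KW Wz; have /nbhsCP[d d0 dW] : nbhs z W by exact: open_nbhs_nbhs.
  exists (d / 2); split; first lra.
  by move=> w; rewrite /cdisc /= => wd; apply: dW; lra.
pose r (z : C) : R := xget 0 [set d : R | 0 < d /\ cdisc z d `<=` W].
have rP z : K z -> 0 < r z /\ cdisc z (r z) `<=` W.
  move=> /H[d dP].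
  exact: (@xgetPex _ 0 [set d : R | 0 < d /\ cdisc z d `<=` W] (ex_intro _ d dP)).
have [||S SK KS] := cc _ K (fun z => disc z (r z)).
- by move=> z _; exact: open_disc.
- by move=> z Kz; exists z => //; apply: disc_center; case: (rP z Kz).
exists (\bigcup_(z in [set` S]) disc z (r z)), (\bigcup_(z in [set` S]) cdisc z (r z)).
split=> //.
- by apply: bigcup_open => z _; exact: open_disc.
- rewrite bigcup_fset; elim: (S : seq C) => [|z l IH].
    by rewrite big_nil; exact: compact0.
  by rewrite big_cons; apply: compactU => //; exact: compact_cdisc.
- by move=> w [z zS /ltW]; exists z.
- by move=> w [z /SK/set_mem/rP[_]]; apply.
Qed.

End PlaneTopology.

(** * Open mapping and the chordal distance to infinity *)

Section OpenMapping.
Variable R : realType.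
Local Notation C := (CC R).

Lemma cont_neq0 (g : C -> C) : cont g 0 -> g 0 != 0 ->
  exists2 d : R, 0 < d & forall h, cabs h < d -> cabs (g 0) / 2 <= cabs (g h).
Proof.
move=> gc g0; have e0 : 0 < cabs (g 0) / 2 by rewrite divr_gt0// cabs_gt0.
have [d d0 dH] := gc _ e0; exists d => // h hd.
have := dH h; rewrite subr0 => /(_ hd).
by have := cabs_triangle (g 0) (g h) 0; have := cabs_triangle (g h) (g 0) 0;
  rewrite !subr0 (cabsC (g 0)); lra.
Qed.

(** The increment is h or h^2 times a continuous factor that is nonzero at 0, hence bounded below on
    small circles. *)
Lemma D2_isolated (f : C -> C) p a b : D2 f p a b -> (a != 0 \/ b 0 != 0) ->
  exists2 d : R, 0 < d & forall t : R, 0 < t < d ->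
    exists2 m : R, 0 < m & forall h, cabs h = t -> m <= cabs (f (p + h) - f p).
Proof.
move=> [bc fE] ab.
have [a0|a0] := eqVneq a 0.
  have b0 : b 0 != 0 by case: ab => //; rewrite a0 eqxx.
  have [d d0 dH] := cont_neq0 bc b0; exists d => // t /andP[t0 td].
  exists (t * t * (cabs (b 0) / 2)); first by rewrite !mulr_gt0 ?cabs_gt0 ?invr_gt0.
  move=> h ht; rewrite fE a0 mul0r addr0 [f p + _]addrC addrK !cabsM ht.
  by rewrite ler_wpM2l ?mulr_ge0 ?(ltW t0)// dH// ht.
have gc : cont (fun h => a + h * b h) 0.
  by apply: contD; [exact: cont_cst|apply: contM => //; exact: cont_id].
have g0 : a + 0 * b 0 != 0 by rewrite mul0r addr0.
have [d d0 dH] := cont_neq0 gc g0; exists d => // t /andP[t0 td].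
exists (t * (cabs a / 2)); first by rewrite !mulr_gt0 ?cabs_gt0 ?invr_gt0.
move=> h ht; rewrite fE.
have -> : f p + a * h + h * h * b h - f p = h * (a + h * b h) by ring.
rewrite cabsM ht ler_wpM2l ?(ltW t0)//.
by have := dH h; rewrite ht mul0r addr0; apply.
Qed.

(* If w is not attained, 1 / (f - w) violates the maximum principle. *)
Lemma open_mapping (f : C -> C) p a b (r : R) : 0 < r ->
  (forall z, disc p r z -> smooth2 f z) ->
  D2 f p a b -> (a != 0 \/ b 0 != 0) ->
  exists2 e : R, 0 < e & forall w, cabs (w - f p) < e ->
    exists2 z, disc p r z & f z = w.
Proof.
move=> r0 f2 fD ab; have [d d0 dH] := D2_isolated fD ab.
pose t := Num.min (d / 2) (r / 2).
have t0 : 0 < t by rewrite lt_min !divr_gt0.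
have td : t < d by rewrite /t gt_min; apply/orP; left; lra.
have tr : t < r by rewrite /t gt_min; apply/orP; right; lra.
have [|m m0 mH] := dH t; first by rewrite t0.
exists (m / 2); first by rewrite divr_gt0.
move=> w wm; apply: contrapT => nw.
have cdr z : cdisc p t z -> disc p r z by move=> zt; exact: le_lt_trans tr.
have nz z : cdisc p t z -> f z + (- w) != 0.
  move=> zt; apply/eqP => E; apply: nw; exists z; first exact: cdr.
  by apply/eqP; rewrite -subr_eq0 E.
pose phi z := (f z + (- w))^-1.
have phi2 z : cdisc p t z -> smooth2 phi z.
  move=> zt; apply: smooth2_inv; last exact: nz.
  by apply: smooth2_addc; apply: f2; exact: cdr.
have : cabs (phi p) <= (m / 2)^-1.
  apply: (@max_principle _ (cdisc p t) (disc p t) phi).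
  - exact: compact_cdisc.
  - exact: open_disc.
  - by move=> z /ltW.
  - by move=> z /ltW /phi2.
  - by move=> z /phi2 /smooth2_cont.
  - move=> z zt nzt.
    have zE : cabs (z - p) = t.
      by apply/eqP; rewrite eq_le zt /= leNgt; apply/negP.
    have := mH _ zE; rewrite (addrC p) subrK => H.
    rewrite /phi cabsV lef_pV2 ?posrE ?divr_gt0 ?cabs_gt0 ?nz//.
    have := cabs_triangle w (f z) (f p); lra.
  - by rewrite invr_ge0 ltW// divr_gt0.
  - by rewrite /cdisc /= subrr cabs0 ltW.
rewrite /phi cabsV lef_pV2 ?posrE ?divr_gt0 ?cabs_gt0 ?nz//; last first.
  by rewrite /cdisc /= subrr cabs0 ltW.
by rewrite -/(f p - w) cabsC leNgt wm.
Qed.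

End OpenMapping.

Section Chordal.
Variable R : realType.
Local Notation C := (CC R).
Local Notation Chat := (sphere R).

(** The chordal distance to infinity. Through this function, which is 1-Lipschitz, convergence on
    the sphere turns into real inequalities. *)
Definition sg (p : Chat) : R := chordal p None.

Lemma sgE (z : C) : sg (to_sphere z) = (Num.sqrt (1 + cabs z ^+ 2))^-1.
Proof. by []. Qed.

Lemma root_gt0 (x : R) : 0 < Num.sqrt (1 + x ^+ 2).
Proof. by rewrite sqrtr_gt0 ltr_pwDl// sqr_ge0. Qed.

Lemma sg_gt0 (z : C) : 0 < sg (to_sphere z).
Proof. by rewrite sgE invr_gt0 root_gt0. Qed.

Lemma root_lipschitz (x y : R) :
  `|Num.sqrt (1 + x ^+ 2) - Num.sqrt (1 + y ^+ 2)| <= `|x - y|.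
Proof.
have := root_gt0 x; have := root_gt0 y.
have := @sqr_sqrtr R (1 + x ^+ 2); have := @sqr_sqrtr R (1 + y ^+ 2).
rewrite !addr_ge0 ?sqr_ge0 ?ler01// => /(_ isT) + /(_ isT).
move: (Num.sqrt _) (Num.sqrt _) => b a ay ax b0 a0.
rewrite -(@ler_pXn2r _ 2) ?nnegrE// !real_normK ?num_real//.
(* Cauchy-Schwarz for the vectors (1, x) and (1, y). *)
have H : 1 + x * y <= a * b.
  have : (1 + x * y) ^+ 2 <= (a * b) ^+ 2.
    by rewrite exprMn ax ay; have := sqr_ge0 (x - y); nra.
  have [h|h] := lerP 0 (1 + x * y); last by have := mulr_gt0 b0 a0; nra.
  by rewrite ler_pXn2r ?nnegrE ?mulr_ge0 ?(ltW a0) ?(ltW b0).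
nra.
Qed.

Lemma sg_lipschitz (z : C) (q : Chat) :
  `|sg (to_sphere z) - sg q| <= chordal (to_sphere z) q.
Proof.
case: q => [w|]; last first.
  by rewrite /sg /= subr0 ger0_norm// invr_ge0 ltW// root_gt0.
rewrite /sg /=.
have a0 := root_gt0 (cabs z); have b0 := root_gt0 (cabs w).
have H := root_lipschitz (cabs w) (cabs z).
have H' : `|cabs w - cabs z| <= cabs (z - w).
  rewrite ler_norml; have := cabs_triangle z w 0; have := cabs_triangle w z 0.
  rewrite !subr0 (cabsC w); move: (cabs z) (cabs w) (cabs (z - w)) => *; lra.
move: (Num.sqrt (1 + cabs z ^+ 2)) (Num.sqrt (1 + cabs w ^+ 2)) a0 b0 H => a b a0 b0 H.
have -> : a^-1 - b^-1 = (b - a) / (a * b) by field; rewrite !gt_eqF.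
rewrite normrM normfV (gtr0_norm (mulr_gt0 a0 b0)).
by rewrite ler_wpM2r ?invr_ge0 ?mulr_ge0 ?(ltW a0) ?(ltW b0)//; apply: le_trans H'.
Qed.

Lemma sg_lipschitzC (z w : C) :
  `|sg (to_sphere z) - sg (to_sphere w)| <= cabs (z - w).
Proof.
apply: le_trans (sg_lipschitz _ _) _; rewrite /= ler_pdivrMr ?mulr_gt0 ?root_gt0//.
rewrite ler_peMr ?cabs_ge0// -[X in X <= _]mulr1.
have r1 (x : R) : 1 <= Num.sqrt (1 + x ^+ 2).
  by rewrite -[X in X <= _]sqrtr1 ler_wsqrtr// lerDl sqr_ge0.
by apply: ler_pM.
Qed.

Lemma sg_small (e : R) (z : C) : 0 < e -> e^-1 < cabs z -> sg (to_sphere z) < e.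
Proof.
move=> e0 ez; rewrite sgE invf_plt ?posrE ?root_gt0//.
apply: lt_le_trans ez _.
rewrite -[X in X <= _]ger0_norm ?cabs_ge0// -sqrtr_sqr ler_wsqrtr//.
by rewrite lerDr.
Qed.

Lemma sg_large (M : R) (z : C) : cabs z <= M -> sg (to_sphere (rc M)) <= sg (to_sphere z).
Proof.
move=> zM; rewrite !sgE cabs_rc lef_pV2 ?posrE ?root_gt0// ler_wsqrtr// lerD2l.
by rewrite lerXn2r ?nnegrE ?cabs_ge0//; apply: le_trans zM (ler_norm _).
Qed.

End Chordal.

(** * Escaping Fatou components *)

Section Escape.
Variable R : realType.
Local Notation C := (CC R).
Local Notation Chat := (sphere R).
Variable f : C -> C.

Definition escapes (z : C) : Prop :=
  forall M : R, exists N, forall n, (N <= n)%N -> M < cabs (iter n f z).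

Definition unif_escapes (V : set C) : Prop :=
  forall M : R, exists N, forall n, (N <= n)%N -> forall w, V w -> M < cabs (iter n f w).

Lemma unif_escapesS (V W : set C) : V `<=` W -> unif_escapes W -> unif_escapes V.
Proof. by move=> VW H M; have [N NH] := H M; exists N => n /NH h w /VW /h. Qed.

Lemma unif_escapesU (V W : set C) :
  unif_escapes V -> unif_escapes W -> unif_escapes (V `|` W).
Proof.
move=> uV uW M; have [N NH] := uV M; have [N' N'H] := uW M.
exists (maxn N N') => n; rewrite geq_max => /andP[Nn N'n] w [Vw|Ww].
  exact: NH.
exact: N'H.
Qed.

Lemma fatou_open : open (fatou_set f).
Proof.
rewrite openE => z [W [oW Wz WC nW]].
rewrite /interior; have : nbhs z W by exact: open_nbhs_nbhs.
by apply: filterS => w Ww; exists W.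
Qed.

Lemma strict_subsequence (P : nat -> Prop) : (forall N, exists2 n, (N <= n)%N & P n) ->
  exists2 s : nat -> nat, {homo s : m n / (m < n)%N} & forall n, P (s n).
Proof.
move=> H.
have [t tP] : {t : nat -> nat & forall N, (N <= t N)%N /\ P (t N)}.
  apply: (@boolp.choice _ _ (fun N n => (N <= n)%N /\ P n)) => N.
  by have [n ? ?] := H N; exists n.
pose s := fix s n := if n is n'.+1 then t (s n').+1 else t 0%N.
exists s; last by case=> [|n]; exact: (tP _).2.
apply: homo_ltn; first exact: ltn_trans.
by move=> n; exact: (tP _).1.
Qed.

Lemma chordal_xx (p : Chat) : chordal p p = 0.
Proof. by case: p => [z|] //=; rewrite subrr cabs0 mul0r. Qed.

(** Along a sequence of iterates either one exponent occurs infinitely often, which gives a constant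
    subsequence, or the exponents tend to infinity and the sequence itself converges uniformly to
    infinity. *)
Lemma unif_escapes_normal (V : set C) : unif_escapes V -> normal_family V (iterates f).
Proof.
move=> uV h hF.
have [k kE] : {k : nat -> nat & forall n, h n = @to_sphere R \o iter (k n) f}.
  apply: (@boolp.choice _ _ (fun n m => h n = @to_sphere R \o iter m f)) => n.
  by have [m mE] := hF n; exists m.
have [[m mP]|nm] := pselect (exists m, forall N, exists2 n, (N <= n)%N & k n = m).
  have [s sh sP] := strict_subsequence mP; exists s => //.
  exists (@to_sphere R \o iter m f) => z Vz; exists setT; first exact: filterT.
  move=> e e0; exists 0%N => // n _ w _ _.
  by rewrite /= kE sP chordal_xx.
have fin j : exists N, forall n, (N <= n)%N -> (j <= k n)%N.
  elim: j => [|j [N NH]]; first by exists 0%N.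
  have [N' N'H] : exists N', forall n, (N' <= n)%N -> k n <> j.
    apply: contrapT => nN; apply: nm; exists j => N'; apply: contrapT => nn.
    by apply: nN; exists N' => n N'n knj; apply: nn; exists n.
  exists (maxn N N') => n; rewrite geq_max => /andP[/NH jk /N'H kj].
  by rewrite ltn_neqAle jk andbT; apply/eqP => /esym.
exists id => //; exists (fun=> None) => z Vz; exists setT; first exact: filterT.
move=> e e0; have [N NH] := uV e^-1; have [N' N'H] := fin N.
exists N' => // n /N'H Nk w _ Vw.
by rewrite /= kE; apply: sg_small => //; exact: NH.
Qed.

Lemma unif_escapes_fatou (z : C) (d : R) : z != 0 -> 0 < d ->
  unif_escapes (disc z d) -> fatou_set f z.
Proof.
move=> z0 d0 ud; exists (disc z (Num.min d (cabs z))); split.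
- exact: open_disc.
- by apply: disc_center; rewrite lt_min d0 cabs_gt0.
- move=> w; rewrite /disc /= lt_min => /andP[_]; rewrite /Cstar /=.
  by apply: contraTneq => ->; rewrite sub0r cabsN ltxx.
- apply: unif_escapes_normal; apply: unif_escapesS ud => w.
  by rewrite /disc /= lt_min => /andP[].
Qed.

Hypothesis f_neq0 : forall z, f z != 0.
Hypothesis f_smooth : forall z, z != 0 -> smooth2 f z.

Lemma iter_neq0 n z : z != 0 -> iter n f z != 0.
Proof. by case: n => //= n _; exact: f_neq0. Qed.

Lemma iter_smooth n z : z != 0 -> smooth2 (iter n f) z.
Proof.
move=> z0; elim: n => [|n IH]; first exact: smooth2_id.
apply: (smooth2_comp IH); apply: f_smooth; exact: iter_neq0.
Qed.

Lemma sg_iter_cont n z (e : R) : z != 0 -> 0 < e -> exists2 d : R, 0 < d &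
  forall w, cabs (w - z) < d ->
    `|sg (to_sphere (iter n f w)) - sg (to_sphere (iter n f z))| < e.
Proof.
move=> z0 e0; have [d d0 dH] := smooth2_cont (iter_smooth n z0) e0.
by exists d => // w /dH; apply: le_lt_trans; exact: sg_lipschitzC.
Qed.

(** The form in which normality is applied. The bound of the radius by |b| keeps 0 out of the
    disc. *)
Lemma fatou_subsequence (b : C) (k : nat -> nat) : fatou_set f b ->
  exists2 s : nat -> nat, {homo s : m n / (m < n)%N} &
  exists (g : C -> Chat) (d : R), [/\ 0 < d, d <= cabs b &
    forall e : R, 0 < e -> exists N, forall n, (N <= n)%N -> forall w, disc b d w ->
      `|sg (to_sphere (iter (k (s n)) f w)) - sg (g w)| < e].
Proof.
move=> [W [oW Wb WC nW]].
have [|s sh [g gl]] := nW (fun n => @to_sphere R \o iter (k n) f).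
  by move=> n; exists (k n).
exists s => //; exists g.
have [V Vb VH] := gl b Wb.
have /nbhsCP[d d0 dVW] : nbhs b (V `&` W) by apply: filterI => //; exact: open_nbhs_nbhs.
have b0 : 0 < cabs b by rewrite cabs_gt0; exact: (WC b Wb).
exists (Num.min d (cabs b)); split; first by rewrite lt_min d0.
  by rewrite ge_min lexx orbT.
move=> e /VH[N _ NH]; exists N => n Nn w; rewrite /disc /= lt_min => /andP[wd _].
have [Vw Ww] := dVW w wd.
apply: le_lt_trans (sg_lipschitz _ _) _; exact: NH.
Qed.

Lemma escapes_closed (b : C) : fatou_set f b ->
  (forall d : R, 0 < d -> exists2 z, disc b d z & escapes z) -> escapes b.
Proof.
move=> Fb lim; apply: contrapT => /existsNP[M nM].
have [k kP] : {k : nat -> nat & forall j, (j <= k j)%N /\ cabs (iter (k j) f b) <= M}.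
  apply: (@boolp.choice _ _ (fun j m => (j <= m)%N /\ cabs (iter m f b) <= M)) => j.
  apply: contrapT => nj; apply: nM; exists j => n jn.
  by rewrite ltNge; apply/negP => nM; apply: nj; exists n.
have [s sh [g [d [d0 db gH]]]] := fatou_subsequence k Fb.
have s_ge n : (n <= s n)%N by elim: n => // n IH; apply: leq_ltn_trans IH (sh _ _ _).
(* A quarter, because four errors below [e] add up. For an escaping [z] near [b], the chain runs
   from a late iterate of [z], close to infinity, via [g z] to the iterate [N] of the subsequence at
   [z] and then at [b], where the distance to infinity is at least [4 * e]. *)
pose e := sg (to_sphere (rc M)) / 4.
have e0 : 0 < e by rewrite divr_gt0// sg_gt0.
have [N NH] := gH e e0.
have b0 : b != 0 by rewrite -cabs_gt0; exact: lt_le_trans db.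
have [d' d'0 d'H] := sg_iter_cont (k (s N)) b0 e0.
have [|z zd zesc] := lim (Num.min d d'); first by rewrite lt_min d0.
move: zd; rewrite /disc /= lt_min => /andP[zd zd'].
have [N' N'H] := zesc e^-1.
have Nn : (N <= maxn N N')%N by exact: leq_maxl.
have Nk : (N' <= k (s (maxn N N')))%N.
  apply: leq_trans (leq_maxr N N') _; apply: leq_trans (s_ge _) _; exact: (kP _).1.
have H1 := sg_small e0 (N'H _ Nk).
have := NH _ Nn z zd; have := NH _ (leqnn _) z zd; have := d'H z zd'.
have := sg_large (kP (s N)).2; rewrite !ltr_norml -/e.
have : sg (to_sphere (rc M)) = 4 * e by rewrite /e; field.
have key (e' a b' c d1 m : R) : a < e' -> m = 4 * e' -> m <= d1 ->
    - e' < c - d1 < e' -> - e' < c - b' < e' -> - e' < a - b' < e' -> False.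
  by clear=> ? ? ? /andP[? ?] /andP[? ?] /andP[? ?]; lra.
exact: key H1.
Qed.

Lemma escapes_locally_large (b : C) : fatou_set f b -> escapes b ->
  exists d : R, [/\ 0 < d, d <= cabs b & exists N, forall n, (N <= n)%N ->
    forall w, disc b d w -> 1 < cabs (iter n f w)].
Proof.
move=> Fb besc.
have b0 : b != 0 by have [W [_ Wb WC _]] := Fb; exact: (WC b Wb).
have B0 : 0 < cabs b by rewrite cabs_gt0.
apply: contrapT => nd.
have [k kP] : {k : nat -> nat * C & forall j : nat, (j <= (k j).1)%N /\
    (cabs ((k j).2 - b) < Num.min j.+1%:R^-1 (cabs b) /\ cabs (iter (k j).1 f (k j).2) <= 1)}.
  apply: (@boolp.choice _ _ (fun (j : nat) (p : nat * C) => (j <= p.1)%N /\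
    (cabs (p.2 - b) < Num.min j.+1%:R^-1 (cabs b) /\ cabs (iter p.1 f p.2) <= 1))) => j.
  apply: contrapT => nj; apply: nd.
  exists (Num.min j.+1%:R^-1 (cabs b)); split.
  - by rewrite lt_min B0 invr_gt0 ltr0n.
  - by rewrite ge_min lexx orbT.
  exists j => n jn w wd; rewrite ltNge; apply/negP => w1; apply: nj.
  by exists (n, w).
have [s sh [g [d [d0 db gH]]]] := fatou_subsequence (fun j => (k j).1) Fb.
have s_ge n : (n <= s n)%N by elim: n => // n IH; apply: leq_ltn_trans IH (sh _ _ _).
pose e := sg (to_sphere (rc (1 : R))) / 4.
have e0 : 0 < e by rewrite divr_gt0// sg_gt0.
have [N NH] := gH e e0.
have [N' N'H] := besc e^-1.
pose m := maxn N N'.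
have Nm : (N <= m)%N by exact: leq_maxl.
have Nk : (N' <= (k (s m)).1)%N.
  apply: leq_trans (leq_maxr N N') _; apply: leq_trans (s_ge _) _; exact: (kP _).1.
have H1 := sg_small e0 (N'H _ Nk).
have [d' d'0 d'H] := sg_iter_cont (k (s m)).1 b0 e0.
(* The order of choices matters: [m] is fixed by the escape of [b], and [j] is then so large that
   the bad point lies where the iterate belonging to [m] is still close to its value at [b]. *)
pose j := (m + Num.truncn (Num.min d d')^-1)%N.
have dd0 : 0 < Num.min d d' by rewrite lt_min d0.
have jd : j.+1%:R^-1 < Num.min d d'.
  rewrite invf_plt ?posrE ?ltr0n//.
  apply: lt_le_trans (truncnS_gt _) _; rewrite ler_nat ltnS /j.
  exact: leq_addl.
have [kj1 [kj2 kj3]] := kP (s j).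
have wd : cabs ((k (s j)).2 - b) < Num.min d d'.
  apply: lt_le_trans kj2 _; rewrite ge_min; apply/orP; left.
  apply: le_trans (ltW jd); rewrite lef_pV2 ?posrE ?ltr0n// ler_nat ltnS.
  exact: s_ge.
move: wd; rewrite lt_min => /andP[wd wd'].
have Nj : (N <= j)%N by apply: leq_trans Nm _; exact: leq_addr.
have := NH _ Nj _ wd; have := NH _ Nm _ wd; have := d'H _ wd'.
have := sg_large kj3; rewrite !ltr_norml.
have : sg (to_sphere (rc (1 : R))) = 4 * e by rewrite /e; field.
have key (e' a b' c d1 m' : R) : a < e' -> m' = 4 * e' -> m' <= d1 ->
    - e' < c - a < e' -> - e' < c - b' < e' -> - e' < d1 - b' < e' -> False.
  by clear=> ? ? ? /andP[? ?] /andP[? ?] /andP[? ?]; lra.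
exact: key H1.
Qed.

Variable L : C -> C.
Hypothesis L_smooth : forall z, z != 0 -> smooth2 L z.
Hypothesis L_log : forall z, z != 0 -> cabs (f z) = expR (re (L z)).

(** Once |f^(n+1)| > 1 on a disc, its logarithm is the positive real part of L(f^n), and Harnack's
    inequality transfers the growth at [b] to the quarter disc. *)
Lemma escapes_locally_unif (b : C) : fatou_set f b -> escapes b ->
  exists2 d : R, 0 < d & unif_escapes (disc b d).
Proof.
move=> Fb besc; have [d [d0 db [N NH]]] := escapes_locally_large Fb besc.
have nz w : disc b d w -> w != 0.
  by rewrite /disc /=; apply: contraTneq => ->; rewrite sub0r cabsN -leNgt.
pose r := d / 2; have r0 : 0 < r by rewrite divr_gt0.
have rd z : cdisc b r z -> disc b d z.
  by rewrite /cdisc /disc /= /r => H; apply: le_lt_trans H _; lra.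
exists (r / 4); first by rewrite divr_gt0.
move=> M.
(* The factor 16/3 undoes the Harnack constant 3/16. *)
have [N' N'H] := besc (expR (16 / 3 * M)).
exists (maxn N N').+1 => n nN w wd.
case: n nN => // n; rewrite ltnS geq_max => /andP[Nn N'n].
pose G z := L (iter n f z).
have GE z : z != 0 -> cabs (iter n.+1 f z) = expR (re (G z)).
  by move=> z0; rewrite iterS L_log//; exact: iter_neq0.
have G2 z : cdisc b r z -> smooth2 G z.
  move=> /rd/nz z0; apply: (smooth2_comp (iter_smooth n z0)).
  by apply: L_smooth; exact: iter_neq0.
have G0 z : cdisc b r z -> 0 < re (G z).
  move=> zr; have zd := rd z zr; have := NH n.+1 (leqW Nn) z zd.
  by rewrite GE ?nz// expR_gt1.
have cw : cdisc b (r / 4) w by exact: ltW.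
have := weak_harnack r0 G2 G0 cw.
have cb : disc b d b by exact: disc_center.
have := N'H n.+1 (leqW N'n); rewrite GE ?nz// ltr_expR => H1 H2.
have wr : cdisc b r w by apply: le_trans cw _; lra.
rewrite GE; last by apply: nz; exact: rd.
apply: lt_le_trans (expR_ge1Dx _); lra.
Qed.

Hypothesis f_open : forall p (d : R), p != 0 -> 0 < d ->
  exists2 e : R, 0 < e & forall w, cabs (w - f p) < e -> exists2 z, disc p d z & f z = w.

Variable z0 : C.
Hypothesis Fz0 : fatou_set f z0.
Hypothesis z0_escapes : escapes z0.

Let U := connected_component (fatou_set f) z0.

Lemma component_neq0 z : U z -> z != 0.
Proof. by move=> /connected_component_sub[W [_ Wz WC _]]; exact: (WC z Wz). Qed.

Lemma component_escapes : U `<=` escapes.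
Proof.
have cU : connected U by exact: component_connected.
have H : U `&` escapes = U.
  apply: cU.
  - by exists z0; split=> //; exact: connected_component_refl.
  - exists [set z | exists2 d : R, 0 < d & unif_escapes (disc z d)].
      rewrite openE => z [d d0 ud]; apply/nbhsCP; exists (d / 2); first by rewrite divr_gt0.
      move=> w wd; exists (d / 2); first by rewrite divr_gt0.
      apply: unif_escapesS ud => u; rewrite /disc /= => uw.
      by have := cabs_triangle w u z; lra.
    apply/seteqP; split=> z [Uz].
      move=> zesc; split=> //; apply: escapes_locally_unif => //;
      exact: connected_component_sub Uz.
    move=> [d d0 ud]; split=> // M; have [N NH] := ud M; exists N => n /NH; apply.
    exact: disc_center.
  - exists (closure escapes); first exact: closed_closure.
    apply/seteqP; split=> z [Uz].
      by move=> zesc; split=> //; exact: subset_closure.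
    move=> cz; split=> //; apply: escapes_closed; first exact: connected_component_sub Uz.
    move=> d d0; have [w [wesc wd]] := cz _ (nbhs_disc z d0).
    by exists w.
by rewrite -H => z [].
Qed.

Lemma component_unif z : U z -> exists2 d : R, 0 < d & unif_escapes (disc z d).
Proof.
move=> Uz; apply: escapes_locally_unif; first exact: connected_component_sub Uz.
exact: component_escapes.
Qed.

(** By openness, the image of a uniformly escaping disc contains a disc around the image point,
    which puts that point into the Fatou set; connectedness keeps the image in [U]. *)
Lemma component_invariant : U (f z0) -> f @` U `<=` U.
Proof.
move=> Ufz0.
have fF z : U z -> fatou_set f (f z).
  move=> Uz; have [d d0 ud] := component_unif Uz.
  have [e e0 eH] := f_open (component_neq0 Uz) d0.
  apply: (unif_escapes_fatou (f_neq0 z) e0) => M.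
  have [N NH] := ud M; exists N => n Nn w /eH[u ud' <-].
  by rewrite -iterSr; apply: NH => //; exact: leqW.
have fc : connected (f @` U).
  apply: connected_continuous_connected; first exact: component_connected.
  apply: continuous_in_subspaceT => z /set_mem Uz.
  by apply/contP; apply: smooth2_cont; apply: f_smooth; exact: component_neq0.
move=> w fUw; rewrite /U (same_connected_component Ufz0).
exists (f @` U) => //; split=> //.
  by exists z0 => //; exact: connected_component_refl.
by move=> _ [z Uz <-]; exact: fF.
Qed.

Lemma compact_unif_escapes (S : set C) : compact S -> S `<=` U -> unif_escapes S.
Proof.
move=> cS SU.
have cc : cover_compact S by rewrite -compact_cover.
pose r (z : C) : R := xget 0 [set d : R | 0 < d /\ unif_escapes (disc z d)].
have rP z : S z -> 0 < r z /\ unif_escapes (disc z (r z)).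
  move=> /SU/component_unif[d d0 ud].
  exact: (@xgetPex _ 0 [set d : R | 0 < d /\ unif_escapes (disc z d)] (ex_intro _ d (conj d0 ud))).
have [||D DS SD] := cc _ S (fun z => disc z (r z)).
- by move=> z _; exact: open_disc.
- by move=> z Sz; exists z => //; apply: disc_center; case: (rP z Sz).
apply: (unif_escapesS SD).
have {}DS z : z \in (D : seq C) -> S z by move=> /DS/set_mem.
rewrite /cover bigcup_fset; elim: (D : seq C) DS => [|z l IH] DS.
  by rewrite big_nil => M; exists 0%N.
rewrite big_cons; apply: unif_escapesU.
  by case: (rP z); [apply: DS; rewrite inE eqxx|].
by apply: IH => w wl; apply: DS; rewrite inE wl orbT.
Qed.

(* On a hole D of U not containing 0 the maximum principle for 1 / f^n carries the
   escape from a surrounding compact part of U over to D. *)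
Lemma hole_empty (D : set C) : compact D -> ~ D 0 -> open (U `|` D) ->
  U `&` D = set0 -> D = set0.
Proof.
move=> cD D0 oUD UD0.
have oC : open [set z : C | z != 0].
  rewrite openE => z /= z0'; apply/nbhsCP; exists (cabs z); first by rewrite cabs_gt0.
  by move=> w; apply: contraTneq => ->; rewrite sub0r cabsN ltxx.
have [|O [N [opO cN DO ON NW]]] := compact_enlarge cD (openI oUD oC).
  move=> z Dz; split; first by right.
  by apply/eqP => z0'; apply: D0; rewrite -z0'.
have N0 z : N z -> z != 0 by move=> /NW[].
have cS : compact (N `\` O).
  by rewrite setDE; apply: compact_closedI => //; exact: open_closedC.
have SU : N `\` O `<=` U.
  by move=> z [/NW[[//|Dz] _] nO]; case: nO; exact: DO.
have uN : unif_escapes N.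
  (* The bound [1 <= m] makes the reciprocal legitimate, and [M + 1 <= m] recovers a strict
     inequality from the weak one of the maximum principle. *)
  move=> M; pose m := Num.max (M + 1) 1.
  have m1 : 1 <= m by rewrite /m le_max lexx orbT.
  have m0 : 0 < m by exact: lt_le_trans m1.
  have Mm : M + 1 <= m by rewrite /m le_max lexx.
  have [n0 nH] := compact_unif_escapes cS SU m.
  exists n0 => n nn w Nw.
  pose phi z := (iter n f z)^-1.
  have phi2 z : N z -> smooth2 phi z.
    by move=> /N0 z0'; apply: smooth2_inv; [exact: iter_smooth|exact: iter_neq0].
  have pos z : N z -> 0 < cabs (iter n f z).
    by move=> /N0 z0'; rewrite cabs_gt0; exact: iter_neq0.
  have : cabs (phi w) <= m^-1.
    apply: (@max_principle _ N O phi m^-1 cN opO ON) => //.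
    - by move=> z /ON /phi2.
    - by move=> z /phi2 /smooth2_cont.
    - move=> z Nz nOz; rewrite /phi cabsV lef_pV2 ?posrE ?pos//.
      by apply: ltW; apply: nH.
    - by rewrite invr_ge0 ltW.
  rewrite /phi cabsV lef_pV2 ?posrE ?pos// => H.
  by apply: lt_le_trans H; apply: lt_le_trans Mm; rewrite ltrDl.
apply: (compact_hole_empty fatou_open cD _ oUD UD0) => z Dz.
have /nbhsCP[d d0 dO] : nbhs z O by apply: open_nbhs_nbhs; split=> //; exact: DO.
apply: (@unif_escapes_fatou z d) => //; first by apply: N0; apply: ON; exact: DO.
by apply: unif_escapesS uN => w /dO /ON.
Qed.

Hypothesis Ufz0 : U (f z0).
Variable r : R.
Hypothesis r0 : 0 < r.
Hypothesis circleU : forall z, cabs z = r -> U z.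

Let X : set Chat := ~` (@to_sphere R @` U).

Let closed_X : closed X.
Proof.
apply: open_closedC; apply: open_to_sphere; apply: open_component; exact: fatou_open.
Qed.

Let X0 : X (to_sphere 0).
Proof. by move=> [z Uz /to_sphere_inj z0']; have := component_neq0 Uz; rewrite z0' eqxx. Qed.

Let Xoo : X None.
Proof. by move=> [z]. Qed.

Lemma complement_component (x : Chat) : X x ->
  connected_component X x (to_sphere 0) \/ connected_component X x None.
Proof.
move=> Xx; apply: contrapT => /not_orP[n0 noo].
have [D [[DX cD cXD] Dx D0 Doo]] :=
  @separate_from_component R _ (@hausdorff_sphere R) (@compact_sphere R) X x _ _ closed_X Xx n0 noo.
pose D' : set C := @to_sphere R @^-1` D.
have cD' : closed D'.
  by apply: closed_comp => // z _; exact: to_sphere_continuous.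
(* A neighbourhood of infinity missing [D] confines [D] to a compact set of the plane. *)
have [W [cW _] WD] : nbhs (None : Chat) (~` D).
  by apply: open_nbhs_nbhs; split=> //; exact: closed_openC.
have cpD' : compact D'.
  apply: (subclosed_compact cD' cW) => z Dz; apply: contrapT => nW.
  by have := WD (to_sphere z); apply=> //; left; exists z.
(* [D] being clopen in the complement, [U] together with the hole is the complement of the closed
   rest. *)
have oUD : open (U `|` D').
  rewrite (_ : U `|` D' = @to_sphere R @^-1` (~` (X `\` D))).
    apply: open_comp; last exact: closed_openC.
    by move=> z _; exact: to_sphere_continuous.
  apply/seteqP; split=> z.
    by case=> [Uz|Dz] [Xz nDz]; [apply: Xz; exists z|].
  move=> nXD; have [Dz|nDz] := pselect (D (to_sphere z)); first by right.
  left; apply: contrapT => nUz; apply: nXD; split=> //.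
  by move=> [w Uw /to_sphere_inj wz]; apply: nUz; rewrite -wz.
have UD0 : U `&` D' = set0.
  by apply/seteqP; split=> // z [Uz /DX]; apply; exists z.
have E := hole_empty cpD' D0 oUD UD0.
case: x Xx n0 noo Dx => [z|] Xx n0 noo Dx //.
by have : D' z by []; rewrite E.
Qed.

(** Since the circle of radius [r] lies in [U], the open and the closed disc cut the same subset out
    of the component of 0; it is clopen there, so the component stays inside the disc. *)
Lemma components_differ : ~ connected_component X (to_sphere 0) None.
Proof.
set B := connected_component X _ => Boo.
have cB : connected B by exact: component_connected.
have BX : B `<=` X by exact: connected_component_sub.
have E : B `&` (@to_sphere R @` disc 0 r) = B.
  apply: cB.
  - exists (to_sphere 0); split; first exact: connected_component_refl.
    by exists 0 => //; exact: disc_center.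
  - by exists (@to_sphere R @` disc 0 r) => //; apply: open_to_sphere; exact: open_disc.
  - exists (@to_sphere R @` cdisc 0 r).
      apply: compact_closed; first exact: hausdorff_sphere.
      apply: continuous_compact; last exact: compact_cdisc.
      by apply: continuous_subspaceT; exact: to_sphere_continuous.
    apply/seteqP; split=> x [Bx [z zr zx]]; split=> //; exists z => //; first exact: ltW.
    rewrite /disc /= lt_neqAle zr andbT; apply/eqP => zE.
    by apply: (BX x Bx); exists z => //; apply: circleU; rewrite -zE subr0.
by move: Boo; rewrite -E => -[_ []].
Qed.

Lemma component_doubly_connected : doubly_connected U.
Proof.
split.
  split; first by apply: open_component; exact: fatou_open.
  - exact: component_connected.
  - by exists z0; exact: connected_component_refl.
rewrite -/X.
pose K n := connected_component X (if n is 0%N then to_sphere 0 else None).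
have -> : components X = K @` `I_2.
  apply/seteqP; split=> [_ [x Xx <-]|_ [[|[|//]] _ <-]].
  - have [H|H] := complement_component Xx.
      by exists 0%N => //; rewrite /K (same_connected_component H).
    by exists 1%N => //; rewrite /K (same_connected_component H).
  - by exists (to_sphere 0).
  - by exists None.
apply: inj_card_eq => n m /set_mem + /set_mem.
case: n => [|[|n]] //; case: m => [|[|m]] // _ _ KE.
- exfalso; apply: components_differ; rewrite -/(K 0%N) KE.
  exact: connected_component_refl.
- exfalso; apply: components_differ; rewrite -/(K 0%N) -KE.
  exact: connected_component_refl.
Qed.

Lemma component_baker : baker_domain f U.
Proof.
split.
- by exists z0.
- exists 1%N; split=> //; exists U; split=> //; first by exists z0.
  exact: component_invariant.
- exists z0; split; first exact: connected_component_refl.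
  split; first by apply: component_neq0; exact: connected_component_refl.
  move=> [w|]; last by right.
  move=> wom; exfalso.
  have [N NH] := z0_escapes (cabs w + 1).
  have /(_ (@to_sphere R @` disc w 1)) := wom N I.
  case.
    apply: open_nbhs_nbhs; split; first by apply: open_to_sphere; exact: open_disc.
    by exists w => //; exact: disc_center.
  move=> _ [[k Nk <-] [u uw /to_sphere_inj uE]].
  have := NH k Nk; move: uw; rewrite uE /disc /=.
  by have := cabs_triangle (iter k f z0) w 0; have := cabs_triangle w (iter k f z0) 0;
    rewrite !subr0; lra.
Qed.

End Escape.

(** * Conclusion *)

Section CircleAndRay.
Variable R : realType.
Local Notation C := (CC R).

Lemma continuous_RC (g : R -> C) (A : set R) :
  (forall x, {for x, continuous (fun t => re (g t))}) ->
  (forall x, {for x, continuous (fun t => im (g t))}) ->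
  {within A, continuous g}.
Proof.
move=> gr gi; apply: continuous_subspaceT => x V /nbhsCP[e e0 eV].
have e2 : 0 < e / 2 by rewrite divr_gt0.
have /gr/nbhs_RP[d d0 dH] : nbhs (re (g x)) [set y | `|y - re (g x)| < e / 2].
  by apply/nbhs_RP; exists (e / 2).
have /gi/nbhs_RP[d' d'0 d'H] : nbhs (im (g x)) [set y | `|y - im (g x)| < e / 2].
  by apply/nbhs_RP; exists (e / 2).
apply/nbhs_RP; exists (Num.min d d'); first by rewrite lt_min d0.
move=> y; rewrite lt_min => /andP[/dH /= ? /d'H /= ?]; apply: eV.
by apply: le_lt_trans (cabs_le_reim _) _; rewrite !reimE; lra.
Qed.

Lemma ray_connected (r : R) : connected (@rc R @` `[r, +oo[%classic).
Proof.
apply: connected_continuous_connected.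
  by apply/connected_intervalP; exact: interval_is_interval.
by apply: continuous_RC => x; [exact: cvg_id|exact: cvg_cst].
Qed.

Lemma circle_connected (r : R) : 0 < r -> connected [set z : C | cabs z = r].
Proof.
move=> r0.
pose g (s : R) x := mkc x (s * Num.sqrt (r ^+ 2 - x ^+ 2)).
have cg s : connected (g s @` `[- r, r]%classic).
  apply: connected_continuous_connected; first exact: segment_connected.
  apply: continuous_RC => x; first exact: cvg_id.
  apply: cvgM; first exact: cvg_cst.
  apply: (@continuous_comp _ _ _ (fun x : R => r ^+ 2 - x ^+ 2) (@Num.sqrt R)).
    by apply: cvgB; [exact: cvg_cst|exact: exprn_continuous].
  exact: sqrt_continuous.
have -> : [set z : C | cabs z = r] = (g 1 @` `[- r, r]%classic) `|` (g (- 1) @` `[- r, r]%classic).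
  apply/seteqP; split=> [z /= zr|z].
    have rz : `[- r, r]%classic (re z).
      by rewrite /= in_itv /= -ler_norml -zr cabs_ge_re.
    have E : Num.sqrt (r ^+ 2 - re z ^+ 2) = `|im z|.
      by rewrite -zr cabs_sqr addrC addKr sqrtr_sqr.
    have [i0|i0] := lerP 0 (im z); [left|right]; exists (re z) => //;
      apply: complex_ext; rewrite /g ?re_mkc ?im_mkc// E.
      by rewrite mul1r ger0_norm.
    by rewrite mulN1r ltr0_norm// opprK.
  have H s : s ^+ 2 = 1 -> (g s @` `[- r, r]%classic) z -> cabs z = r.
    move=> s2 [x]; rewrite /= in_itv /= => /andP[x1 x2] <-.
    have q0 : 0 <= r ^+ 2 - x ^+ 2 by nra.
    apply/eqP; rewrite -(@eqrXn2 _ 2) ?cabs_ge0 ?(ltW r0)//; apply/eqP.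
    by rewrite cabs_sqr /g re_mkc im_mkc exprMn s2 mul1r sqr_sqrtr// addrC subrK.
  by case; apply: H; rewrite ?sqrrN expr1n.
apply: connectedU => //; exists (rc r).
have rr : `[- r, r]%classic r by rewrite /= in_itv /= lexx andbT; lra.
by split; exists r => //; rewrite /g subrr sqrtr0 mulr0.
Qed.

End CircleAndRay.

Section Conclusion.
Variable R : realType.
Local Notation C := (CC R).

Lemma baker_map_open (eps : R) : (forall p : C, p != 0 ->
    ein' p - rc eps * p^-1 ^+ 2 = 0 -> ein'' p / 2 + rc eps * p^-1 ^+ 3 != 0) ->
  forall p (d : R), p != 0 -> 0 < d ->
  exists2 e : R, 0 < e & forall w, cabs (w - baker_map eps p) < e ->
    exists2 z, disc p d z & baker_map eps z = w.
Proof.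
move=> crit p d p0 d0.
have [b bE bD] := baker_map_D2 eps p0.
(* A radius of at most |p| keeps the disc away from 0, where smoothness fails. *)
pose d' := Num.min d (cabs p).
have d'0 : 0 < d' by rewrite lt_min d0 cabs_gt0.
have [||e e0 eH] := open_mapping d'0 _ bD _.
- move=> z; rewrite /disc /= lt_min => /andP[_ zp]; apply: baker_map_smooth2.
  by apply: contraTneq zp => ->; rewrite sub0r cabsN ltxx.
- have [g0|g0] := eqVneq (baker_log' eps p) 0; last by left; rewrite mulf_neq0 ?baker_map_neq0.
  by right; rewrite (bE g0) mulf_neq0 ?baker_map_neq0//; exact: crit.
exists e => // w /eH[z]; rewrite /disc /= lt_min => /andP[zd _] zw.
by exists z.
Qed.

(** The condition is put on the image of [z], because a circle around 0 is not contained in the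
    cone. A whole disc is mapped into the open cone, where real parts at least double at each
    step. *)
Lemma baker_map_unif_escapes (eps : R) (z : C) : 0 < eps -> eps <= 1 -> z != 0 ->
  cone (baker_map eps z) ->
  exists2 d : R, 0 < d & unif_escapes (baker_map eps) (disc z d).
Proof.
move=> eps0 eps1 z0 cz.
have fc := smooth2_cont (baker_map_smooth2 eps z0).
have /nbhsCP[e e0 eH] : nbhs (baker_map eps z) (@cone R).
  by apply: open_nbhs_nbhs; split=> //; exact: open_cone.
have [d d0 dH] := fc e e0; exists d => // M.
(* One step is spent on entering the cone; the other unit ensures n > M, and thus 2^n > M. *)
exists (Num.truncn M).+2 => -[|n] // nN w wd.
have [_ H] := iter_baker_map_cone eps0 eps1 n (eH _ (dH w wd)).
rewrite iterSr; apply: lt_le_trans (cabs_ge_re _).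
apply: lt_le_trans (ler_norm _); apply: lt_le_trans H.
apply: lt_le_trans (truncnS_gt M) _.
by rewrite -natrX ler_nat; apply: leq_trans (ltnW (ltn_expl n _)); rewrite // -ltnS.
Qed.

Lemma baker_map_log (eps : R) (z : C) :
  cabs (baker_map eps z) = expR (re (baker_log eps z + rc (ln 64))).
Proof.
rewrite reD re_rc expRD lnK ?posrE// /baker_map cabsM cabs_rc cabs_cexp ger0_norm//.
by rewrite mulrC.
Qed.

(* For |z| = r both Ein z and eps / z are close to 0, so baker_map z is close to 64. *)
Lemma baker_map_parameters : exists eps r : R, [/\ 0 < eps, eps <= 1, 0 < r,
  forall p : C, p != 0 -> ein' p - rc eps * p^-1 ^+ 2 = 0 ->
    ein'' p / 2 + rc eps * p^-1 ^+ 3 != 0 &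
  forall z : C, cabs z = r -> cone (baker_map eps z)].
Proof.
have [e0 e00 crit] := critical_points_simple R.
have [d d0 dH] := cexp_near1 R.
have ec : cont (@ein R) 0.
  by have [b _ bD] := ein_D2 (0 : C); apply: smooth2_cont; exists (ein' 0), b.
have d2 : 0 < d / 2 by rewrite divr_gt0.
have [r r0 rH] := ec _ d2.
have r20 : 0 < r / 2 by rewrite divr_gt0.
(* The radius depends on Ein alone, so it is fixed before eps. On the circle of radius r / 2 the
   last bound gives |eps / z| <= d / 2; the others are for the critical points and for the cone. *)
pose eps := Num.min (Num.min e0 1) (r / 2 * (d / 2)).
exists eps, (r / 2); split=> //.
- by rewrite !lt_min e00 ltr01 mulr_gt0.
- by rewrite !ge_min lexx orbT.
- move=> p p0; apply: crit => //.
  by rewrite !lt_min e00 ltr01 mulr_gt0//= !ge_min lexx.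
move=> z zr; apply: dH.
apply: le_lt_trans (cabsD _ _) _.
have := rH z; rewrite subr0 zr ein0 subr0 => /(_ ltac:(lra)) H.
have : cabs (rc eps * z^-1) <= d / 2.
  rewrite cabsM cabsV zr cabs_rc ger0_norm; last first.
    by rewrite !le_min ltW//= ler01 mulr_ge0// ltW.
  by rewrite ler_pdivrMr// [d / 2 * _]mulrC ge_min lexx orbT.
lra.
Qed.

End Conclusion.

Theorem theorem1p4 (R : realType) :
  exists f : CC R -> CC R,
    transcendental_self_map f /\
    exists U : set (CC R), baker_domain f U /\ doubly_connected U.
Proof.
have [eps [r [eps0 eps1 r0 crit circ]]] := baker_map_parameters R.
set f := baker_map eps.
have pos x : r <= x -> 0 < x by exact: lt_le_trans.
have esc z : z != 0 -> cone (f z) -> exists2 d : R, 0 < d & unif_escapes f (disc z d).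
  by move=> z0 cz; exact: baker_map_unif_escapes.
have Fat z : z != 0 -> cone (f z) -> fatou_set f z.
  by move=> z0 /(esc z z0)[d d0]; exact: unif_escapes_fatou.
have nz (x : R) : 0 < x -> rc x != 0 :> CC R by move=> x0; rewrite -cabs_gt0 cabs_rc gtr0_norm.
have cr : cabs (rc r : CC R) = r by rewrite cabs_rc gtr0_norm.
have Fr : fatou_set f (rc r) by apply: Fat; [exact: nz|exact: circ].
have er : escapes f (rc r).
  have [d d0 ud] := esc (rc r) (nz r r0) (circ _ cr).
  move=> M; have [N NH] := ud M; exists N => n /NH; apply; exact: disc_center.
pose U := connected_component (fatou_set f) (rc r).
have circU z : cabs z = r -> U z.
  move=> zr; exists [set z : CC R | cabs z = r] => //; split=> //; last exact: circle_connected.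
  move=> w /= wr; apply: Fat; last exact: circ.
  by rewrite -cabs_gt0 wr.
have rayU x : r <= x -> U (rc x).
  move=> rx; exists (@rc R @` `[r, +oo[%classic); last first.
    by exists x => //; rewrite /= in_itv /= rx.
  split; last exact: ray_connected.
    by exists r => //; rewrite /= in_itv /= lexx.
  move=> _ [y + <-]; rewrite /= in_itv /= andbT => ry.
  have y0 := pos y ry.
  by apply: Fat; [exact: nz|exact: baker_map_rc_cone].
(* The image of [r] is real and at least 64 (1 + r), so it lies on the ray. The ray is what makes
   [U] meet its own image and hence have period one. *)
have Ufr : U (f (rc r)).
  rewrite /f baker_map_rc; apply: rayU.
  by have := baker_map_rc_ge1 eps0 r0; rewrite baker_map_rc re_rc; lra.
have f_smooth z : z != 0 -> smooth2 f z by exact: baker_map_smooth2.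
have f_neq0 z : f z != 0 by exact: baker_map_neq0.
have L_smooth z : z != 0 -> smooth2 (fun z => baker_log eps z + rc (ln 64)) z.
  by move=> z0; apply: smooth2_addc; exact: baker_log_smooth2.
have L_log z : z != 0 -> cabs (f z) = expR (re (baker_log eps z + rc (ln 64))).
  by move=> _; exact: baker_map_log.
have f_open := baker_map_open crit.
exists f; split; first exact: baker_map_transcendental.
exists U; split.
  exact: (component_baker f_neq0 f_smooth L_smooth L_log f_open Fr er).
exact: (component_doubly_connected f_neq0 f_smooth L_smooth L_log Fr er r0 circU).
Qed.
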